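(* Let $q \geq 4$ be a prime power, let $S = \mathrm{PSL}_2(q)$, and let $C_1, C_2$ be conjugacy classes of $S$ chosen (independently and) uniformly at random among all conjugacy classes of $S$. Then $$\mathbf{P}\big(\langle C_1, C_2\rangle_I = S\big) = \frac12 + O(1/q).$$ That is, there is an absolute constant $K$ such that $\left|\mathbf{P}(\langle C_1, C_2\rangle_I = S) - \tfrac12\right| \leq K/q$ for all such $q$.
   Context: For a finite group $G$ and conjugacy classes $C, D$ of $G$, we write $\langle C, D\rangle_I = G$ (and say that $C$ and $D$ invariably generate $G$) if $\langle x, y\rangle = G$ for every $x \in C$ and every $y \in D$. The pair $(C_1, C_2)$ is a uniformly random ordered pair of conjugacy classes of $S$ (each class, including the trivial one, has the same weight regardless of its size). *)

(* Defs.v *)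
From HB Require Import structures.
From mathcomp Require Import all_boot all_order all_fingroup all_algebra.
From mathcomp Require Import all_solvable.

Set Implicit Arguments.
Unset Strict Implicit.
Unset Printing Implicit Defensive.

Import GroupScope GRing.Theory Num.Theory.

Section SpecialLinear.

Variables (n : nat) (F : finFieldType).

Definition SLset : {set {'GL_n[F]}} := [set g | (\det (GLval g) == 1)%R].

Lemma SLset_group_set : group_set SLset.
Proof.
apply/group_setP; split; first by rewrite inE GL_1E det1.
move=> g h; rewrite !inE => /eqP dg /eqP dh.
by rewrite GL_MxE det_mulmx dg dh mulr1.
Qed.

Canonical SL_group : {group {'GL_n[F]}} := Group SLset_group_set.

Definition PSL : {group coset_of 'Z(SL_group)} :=
  (SL_group / 'Z(SL_group))%G.

End SpecialLinear.

Arguments SLset n%_N F.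
Arguments SL_group n%_N F.
Arguments PSL n%_N F.

Definition invariably_generate (gT : finGroupType) (G C D : {set gT}) : bool :=
  [forall x in C, forall y in D, <<[set x; y]>> == G].

Definition class_pairs (gT : finGroupType) (G : {set gT}) :
    {set {set gT} * {set gT}} :=
  setX (classes G) (classes G).

(* Every ordered pair of classes has the same weight 1 / k(G)^2, so the
   probability is the proportion of favourable pairs. *)
Definition prob_invariably_generate (gT : finGroupType) (G : {set gT}) : rat :=
  (#|[set CD in class_pairs G | invariably_generate G CD.1 CD.2]|%:R
     / #|class_pairs G|%:R)%R.

(* Main.v *)
(** Up to boundedly many exceptions, a conjugacy class of PSL_2(q) is given by a
    trace up to sign, and up to O(1) half of the traces are split and half are
    nonsplit. Two split classes, or two nonsplit classes, have commuting
    representatives, so only mixed pairs can generate invariably.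

    For a mixed pair, let H contain the center Z of SL_2(q), a split x and a nonsplit
    y, both of order at least 4 modulo Z. Commutation is an equivalence relation on
    noncentral elements, so the centralizers partition H minus Z, and, as in
    Dickson's classification, counting elements shows that H contains unipotent
    elements, that they are all conjugate into one group of some order Q, and that
    the tori of x and y have orders (Q - 1) / s and (Q + 1) / s modulo Z with
    s <= 2. Either Q = q and H = SL_2(q), or Q ^ 2 < 2q and
    x ^ (2 (Q - 1)) = 1 = y ^ (2 (Q + 1)). Traces of elements with g ^ n = 1 are
    roots of a polynomial of degree n - 1, so the second case concerns at most about
    4 Q ^ 2 pairs of traces; summed over the powers Q of p with Q ^ 2 < 2q this is
    O(q) among about q ^ 2 pairs. *)
Require Import Defs.
From mathcomp Require Import all_boot all_order all_fingroup all_algebra.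
From mathcomp Require Import all_solvable all_field.
From mathcomp Require Import ring lra zify.

Set Implicit Arguments.
Unset Strict Implicit.
Unset Printing Implicit Defensive.

Import Order.TTheory GroupScope GRing.Theory Num.Theory.

(** * Matrix entries in SL_2 *)

(** Order 4 is the right threshold because of a weight count. The H-conjugates of the noncentral
    part of C_H[g] fill the fraction (t - 1) / (w t) of H, where t is the order of C_H[g] modulo Z
    and w its index in its normalizer. For semisimple g one has w <= 2, so the fraction is at least
    1/4, and at least 3/8 once t >= 4. Since 3/8 + 3/8 + 1/4 = 1 while Z is never covered, x and y
    leave no room for a third semisimple block and force w = 2 for both. The exceptional subgroups
    of Dickson's list therefore never arise, and no subfield has to be constructed: Q enters only
    through divisibility. Conjugacy and commutation are handled through the plane spanned by 1 and g
    in the matrix algebra, which serves split, nonsplit and parabolic elements alike. The condition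
    t^2 = 4 marks parabolic traces in every characteristic. *)

(* Typing elements by this structure rather than by {'GL_2[F]} keeps unification
   from unfolding the group structure of the unit group of matrices. *)
Definition GL2 (F : finFieldType) : finGroupType := {'GL_2[F]}.
Definition SL2 (F : finFieldType) : {group GL2 F} := SL_group 2 F.

Section Entries.
Variable F : finFieldType.
Local Open Scope ring_scope.
Implicit Types (g h k : GL2 F).

Definition m00 g : F := GLval g 0 0.
Definition m01 g : F := GLval g 0 1.
Definition m10 g : F := GLval g 1 0.
Definition m11 g : F := GLval g 1 1.
Definition mtr g := m00 g + m11 g.

Lemma sum_ord2 (f : 'I_2 -> F) : \sum_(i < 2) f i = f 0 + f 1.
Proof. by rewrite !big_ord_recl big_ord0 addr0; congr (_ + f _); apply: val_inj. Qed.

Lemma entM g h i j : GLval (g * h)%g i j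
  = GLval g i 0 * GLval h 0 j + GLval g i 1 * GLval h 1 j.
Proof. by rewrite GL_MxE mxE sum_ord2. Qed.

Lemma entryM g h :
  (m00 (g * h)%g = m00 g * m00 h + m01 g * m10 h) *
  (m01 (g * h)%g = m00 g * m01 h + m01 g * m11 h) *
  (m10 (g * h)%g = m10 g * m00 h + m11 g * m10 h) *
  (m11 (g * h)%g = m10 g * m01 h + m11 g * m11 h).
Proof. by rewrite /m00 /m01 /m10 /m11 !entM. Qed.

Lemma entry1 : (m00 1%g = 1) * (m01 1%g = 0) * (m10 1%g = 0) * (m11 1%g = 1).
Proof. by rewrite /m00 /m01 /m10 /m11 GL_1E !mxE. Qed.

Lemma entryP g h : m00 g = m00 h -> m01 g = m01 h -> m10 g = m10 h ->
  m11 g = m11 h -> g = h.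
Proof.
rewrite /m00 /m01 /m10 /m11 => e0 e1 e2 e3; apply/val_inj/matrixP => /= i j.
have two (l : 'I_2) : l = 0 \/ l = 1.
  by case: l => [[|[|//]]] ?; [left | right]; apply: val_inj.
by case: (two i) => ->; case: (two j) => ->.
Qed.

Lemma det2 (A : 'M[F]_2) : \det A = A 0 0 * A 1 1 - A 0 1 * A 1 0.
Proof.
rewrite (expand_det_row _ 0) sum_ord2 /cofactor !det_mx11 !mxE /= expr0 expr1.
by rewrite mul1r mulN1r mulrN; do !congr (_ * _ + - (_ * _) ); congr (A _ _); apply: val_inj.
Qed.

Lemma SLE g : (g \in SL2 F) = (m00 g * m11 g - m01 g * m10 g == 1).
Proof. by rewrite inE /= (@det2 (GLval g)). Qed.

Lemma SLdet g : g \in SL2 F -> m00 g * m11 g - m01 g * m10 g = 1.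
Proof. by rewrite SLE => /eqP. Qed.

Definition mx2 (a b c d : F) : 'M[F]_2 :=
  \matrix_(i, j) (if i == 0 then if j == 0 then a else b
                  else if j == 0 then c else d).

Definition gl2 (a b c d : F) : GL2 F := insubd (1%g : GL2 F) (mx2 a b c d).

Lemma gl2E a b c d : a * d - b * c = 1 ->
  (m00 (gl2 a b c d) = a) * (m01 (gl2 a b c d) = b) *
  (m10 (gl2 a b c d) = c) * (m11 (gl2 a b c d) = d).
Proof.
move=> e; have u : (mx2 a b c d) \is a GRing.unit.
  by rewrite -[_ \is a _]/(_ \in unitmx) unitmxE det2 !mxE /= e unitr1.
rewrite /m00 /m01 /m10 /m11.
have -> : GLval (gl2 a b c d) = mx2 a b c d.
  by rewrite -[LHS]/(val (gl2 a b c d)) /gl2 val_insubd u.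
by rewrite !mxE.
Qed.

Lemma gl2_SL a b c d : a * d - b * c = 1 -> gl2 a b c d \in SL2 F.
Proof. by move=> e; rewrite SLE !gl2E // e. Qed.

Lemma entryV g : g \in SL2 F ->
  (m00 g^-1%g = m11 g) * (m01 g^-1%g = - m01 g) *
  (m10 g^-1%g = - m10 g) * (m11 g^-1%g = m00 g).
Proof.
move/SLdet => dg.
have e : m11 g * m00 g - - m01 g * - m10 g = 1 by rewrite -dg; ring.
suff -> : g^-1%g = gl2 (m11 g) (- m01 g) (- m10 g) (m00 g) by rewrite !gl2E.
apply/eqP; rewrite eq_invg_mul; apply/eqP.
by apply: entryP; rewrite !entryM !entry1 !gl2E //; first [by ring | by rewrite -dg; ring].
Qed.

Lemma mtrJ g h : h \in SL2 F -> mtr (g ^ h)%g = mtr g.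
Proof.
move=> hS; rewrite /conjg /mtr !entryM !entryV //.
have e := SLdet hS.
rewrite -[RHS]mulr1 -e; ring.
Qed.

(* Two elements commute iff their vectors (m01, m10, m00 - m11) are parallel. *)
Lemma comm_entry g h : reflect [/\ m01 g * m10 h = m01 h * m10 g,
   m01 g * (m00 h - m11 h) = m01 h * (m00 g - m11 g) &
   m10 g * (m00 h - m11 h) = m10 h * (m00 g - m11 g)] (g \in 'C[h]%g).
Proof.
apply: (iffP cent1P) => [e | [e1 e2 e3]].
  have := congr1 m00 e; have := congr1 m01 e; have := congr1 m10 e.
  rewrite !entryM => f1 f2 f3; split.
  - have -> : m01 g * m10 h = m00 g * m00 h + m01 g * m10 h - m00 g * m00 h by ring.
    rewrite f3; ring.
  - apply/eqP; rewrite -subr_eq0; apply/eqP.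
    transitivity (m00 h * m01 g + m01 h * m11 g - (m00 g * m01 h + m01 g * m11 h)).
      by ring.
    by rewrite f2 subrr.
  - apply/eqP; rewrite -subr_eq0; apply/eqP.
    transitivity (m10 g * m00 h + m11 g * m10 h - (m10 h * m00 g + m11 h * m10 g)).
      by ring.
    by rewrite f1 subrr.
apply: entryP; rewrite !entryM; apply/eqP; rewrite -subr_eq0; apply/eqP.
- transitivity (m01 g * m10 h - m01 h * m10 g); [by ring | by rewrite e1 subrr].
- transitivity (- (m01 g * (m00 h - m11 h) - m01 h * (m00 g - m11 g)));
    [by ring | by rewrite e2 subrr oppr0].
- transitivity (m10 g * (m00 h - m11 h) - m10 h * (m00 g - m11 g));
    [by ring | by rewrite e3 subrr].
- transitivity (- (m01 g * m10 h - m01 h * m10 g)); [by ring | by rewrite e1 subrr oppr0].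
Qed.

(** Commuting with the upper and the lower elementary matrix already forces a scalar. *)
Lemma centSLP g : g \in SL2 F ->
  reflect [/\ m01 g = 0, m10 g = 0 & m00 g = m11 g] (g \in 'Z(SL2 F)%g).
Proof.
move=> gS; apply: (iffP (centerP _ _)) => [[_ zg] | [e1 e2 e3]].
  have eu : 1 * 1 - 1 * 0 = 1 :> F by ring.
  have el : 1 * 1 - 0 * 1 = 1 :> F by ring.
  have /cent1P/comm_entry := zg _ (gl2_SL eu); have /cent1P/comm_entry := zg _ (gl2_SL el).
  rewrite !gl2E // => -[h1 h2 h3] [k1 k2 k3].
  move: h1 h3 k1; rewrite !(mul1r, mulr0, subrr, mul0r, mulr1) => -> e <-; split=> //.
  by apply/eqP; rewrite -subr_eq0 -e.
split=> // h hS; apply/cent1P/comm_entry.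
by rewrite e1 e2 e3 subrr; split; rewrite !(mul0r, mulr0).
Qed.

End Entries.

(** * Traces, commutation and conjugacy *)

Section Lin.
Variable F : finFieldType.
Local Open Scope ring_scope.
Implicit Types (g h k : GL2 F).
Local Notation G := (SL2 F).
Local Notation Z := ('Z(G)%g).

Lemma eq_subr0 (x y z : F) : x - y = z -> z = 0 -> x = y.
Proof. by move=> <- /eqP; rewrite subr_eq0 => /eqP. Qed.

Lemma noncentral_entry g : g \in G -> g \notin Z ->
  [\/ m01 g != 0, m10 g != 0 | m00 g - m11 g != 0].
Proof.
move=> gG; have [e1|] := eqVneq (m01 g) 0; last by constructor 1.
have [e2|] := eqVneq (m10 g) 0; last by constructor 2.
have [e3|] := eqVneq (m00 g - m11 g) 0; last by constructor 3.
by case/negP; apply/centSLP => //; split=> //; apply/eqP; rewrite -subr_eq0 e3.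
Qed.

(** The commutant of a nonscalar matrix is spanned by 1 and g. The cases pick a nonzero coordinate
    of (m01, m10, m00 - m11), from which b is read off. *)
Lemma cent_lin g h : g \in G -> g \notin Z -> h \in 'C[g]%g ->
  exists a b, [/\ m00 h = a + b * m00 g, m01 h = b * m01 g,
                  m10 h = b * m10 g & m11 h = a + b * m11 g].
Proof.
move=> gG gZ /comm_entry[e1 e2 e3].
case: (noncentral_entry gG gZ) => nz.
- exists (m00 h - m01 h / m01 g * m00 g), (m01 h / m01 g); split.
  + by ring.
  + by rewrite divfK.
  + by apply: (mulfI nz); rewrite -e1; field.
  + apply: (mulfI nz); apply: (eq_subr0 (z := m01 h * (m00 g - m11 g) - m01 g * (m00 h - m11 h))).
      by field.
    by rewrite e2 subrr.
- exists (m00 h - m10 h / m10 g * m00 g), (m10 h / m10 g); split.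
  + by ring.
  + by apply: (mulfI nz); rewrite mulrC e1; field.
  + by rewrite divfK.
  + apply: (mulfI nz); apply: (eq_subr0 (z := m10 h * (m00 g - m11 g) - m10 g * (m00 h - m11 h))).
      by field.
    by rewrite e3 subrr.
- exists (m00 h - (m00 h - m11 h) / (m00 g - m11 g) * m00 g),
    ((m00 h - m11 h) / (m00 g - m11 g)); split.
  + by ring.
  + by apply: (mulIf nz); rewrite e2; field.
  + by apply: (mulIf nz); rewrite e3; field.
  + by field.
Qed.

Lemma lin_cent g h a b : m00 h = a + b * m00 g -> m01 h = b * m01 g ->
  m10 h = b * m10 g -> m11 h = a + b * m11 g -> h \in 'C[g]%g.
Proof. by move=> e0 e1 e2 e3; apply/comm_entry; rewrite e0 e1 e2 e3; split; ring. Qed.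

(** Both elements lie in the commutative algebra spanned by 1 and g. *)
Lemma comm_trans g h k : g \in G -> g \notin Z -> h \in 'C[g]%g ->
  k \in 'C[g]%g -> h \in 'C[k]%g.
Proof.
move=> gG gZ /(cent_lin gG gZ)[a [b [h0 h1 h2 h3]]] /(cent_lin gG gZ)[c [d [k0 k1 k2 k3]]].
by apply/comm_entry; rewrite h0 h1 h2 h3 k0 k1 k2 k3; split; ring.
Qed.

(** A root in F of the characteristic polynomial of a determinant 1 matrix of trace t. Parabolic
    traces qualify too, so properly split ones also need t^2 != 4. *)
Definition has_eig (t : F) := [exists l : F, l ^+ 2 - t * l + 1 == 0].

Lemma has_eigP t : reflect (exists l, l ^+ 2 - t * l + 1 = 0) (has_eig t).
Proof. by apply: (iffP existsP) => -[l e]; exists l; apply/eqP. Qed.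

Lemma sqr4 (t : F) : t ^+ 2 = 4 -> t = 2 \/ t = -2.
Proof.
move=> e; have /eqP : (t - 2) * (t + 2) = 0.
  by transitivity (t ^+ 2 - 4); [ring | rewrite e subrr].
rewrite mulf_eq0 subr_eq0 addr_eq0 => /orP[] /eqP ->; by [left|right].
Qed.

Lemma parabolic_eig t : t ^+ 2 = 4 -> has_eig t.
Proof. by case/sqr4 => ->; apply/has_eigP; [exists 1 | exists (-1)]; ring. Qed.

Lemma mtr_lin g h a b : m00 h = a + b * m00 g -> m11 h = a + b * m11 g ->
  mtr h = 2 * a + b * mtr g.
Proof. by rewrite /mtr => -> ->; ring. Qed.

Lemma det_lin g h a b : g \in G -> h \in G ->
  m00 h = a + b * m00 g -> m01 h = b * m01 g ->
  m10 h = b * m10 g -> m11 h = a + b * m11 g -> a ^+ 2 + a * b * mtr g + b ^+ 2 = 1.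
Proof.
move=> /SLdet dg /SLdet dh e0 e1 e2 e3; rewrite -dh e0 e1 e2 e3 /mtr.
rewrite -[X in _ + X]mulr1 -dg; ring.
Qed.

Lemma noncentral_lin g h a b : h \in G -> h \notin Z ->
  m00 h = a + b * m00 g -> m01 h = b * m01 g ->
  m10 h = b * m10 g -> m11 h = a + b * m11 g -> b != 0.
Proof.
move=> hG hZ e0 e1 e2 e3; apply: contra hZ => /eqP b0; apply/centSLP => //.
by rewrite e0 e1 e2 e3 b0 !mul0r.
Qed.

(** With h = a + b g, an eigenvalue l of g gives the eigenvalue a + b l of h, and the discriminant
    of h is b^2 times that of g, with b nonzero. *)
Lemma comm_type g h : g \in G -> g \notin Z -> h \in G -> h \notin Z ->
  h \in 'C[g]%g ->
  ((mtr h ^+ 2 == 4) = (mtr g ^+ 2 == 4)) * (has_eig (mtr h) = has_eig (mtr g)).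
Proof.
have eigi g1 h1 : g1 \in G -> g1 \notin Z -> h1 \in G -> h1 \notin Z ->
    h1 \in 'C[g1]%g -> has_eig (mtr g1) -> has_eig (mtr h1).
  move=> gG gZ hG hZ /(cent_lin gG gZ)[a [b [h0 h1' h2 h3]]] /has_eigP[l el].
  apply/has_eigP; exists (a + b * l).
  have dt := det_lin gG hG h0 h1' h2 h3; rewrite (mtr_lin h0 h3).
  transitivity (b ^+ 2 * (l ^+ 2 - mtr g1 * l + 1)
    + (1 - (a ^+ 2 + a * b * mtr g1 + b ^+ 2))); first by ring.
  by rewrite el dt mulr0 subrr addr0.
move=> gG gZ hG hZ hc; split; last first.
  by apply/idP/idP; apply: eigi => //; rewrite cent1C.
case/(cent_lin gG gZ): hc => a [b [h0 h1 h2 h3]].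
have dt := det_lin gG hG h0 h1 h2 h3; rewrite (mtr_lin h0 h3).
have nb := noncentral_lin hG hZ h0 h1 h2 h3.
rewrite -subr_eq0 -[RHS]subr_eq0.
have -> : (2 * a + b * mtr g) ^+ 2 - 4 = b ^+ 2 * (mtr g ^+ 2 - 4).
  by rewrite -[X in _ - X]mulr1 -[X in _ - _ * X]dt; ring.
by rewrite mulf_eq0 sqrf_eq0 (negPf nb).
Qed.

(** In the algebra F[g], equal trace and norm leave only g and its conjugate, which is g^-1 because
    det g = 1. For h = a + b g this reads (b^2 - 1)(t^2 - 4) = 0 and a (a + b t) = 0. *)
Lemma comm_same_trace g h : g \in G -> g \notin Z -> h \in G ->
  h \in 'C[g]%g -> mtr g ^+ 2 != 4 -> mtr h = mtr g -> h = g \/ h = g^-1%g.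
Proof.
move=> gG gZ hG /(cent_lin gG gZ)[a [b [h0 h1 h2 h3]]] t4 et.
have dt := det_lin gG hG h0 h1 h2 h3.
have et' : 2 * a + b * mtr g = mtr g by rewrite -[RHS]et (mtr_lin h0 h3).
have b2 : b ^+ 2 = 1.
  have /eqP : (b ^+ 2 - 1) * (mtr g ^+ 2 - 4) = 0.
    transitivity ((2 * a + b * mtr g) ^+ 2 - mtr g ^+ 2
      + 4 * (1 - (a ^+ 2 + a * b * mtr g + b ^+ 2))); first by ring.
    by rewrite et' dt !subrr mulr0 addr0.
  by rewrite mulf_eq0 !subr_eq0 (negPf t4) orbF => /eqP.
have /eqP : a * (a + b * mtr g) = 0.
  by apply: (addIr (b ^+ 2)); rewrite add0r [RHS]b2 -dt; ring.
(* The remaining combinations of a and b need 2 t = 0, that is trace 0 or characteristic 2, where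
   they again give g or g^-1. *)
have char2 : mtr g + mtr g = 0 -> mtr g = 0 \/ (2 : F) = 0.
  by move=> e; apply/pred2P; rewrite -mulf_eq0 mulr_natr mulr2n e.
have neg2 : (2 : F) = 0 -> forall x : F, - x = x.
  move=> e x; apply: (addIr x); rewrite addNr -mulr2n -mulr_natr e mulr0 //.
have [b1|b1] : b = 1 \/ b = -1 by apply/pred2P; rewrite -sqrf_eq1 b2.
  rewrite mulf_eq0 => /orP[/eqP a0|].
    by left; apply: entryP; rewrite ?h0 ?h1 ?h2 ?h3 ?a0 ?b1; ring.
  rewrite b1 mul1r addr_eq0 => /eqP a0.
  have /char2[t0|/neg2 e] : mtr g + mtr g = 0.
    have: mtr g - (2 * a + b * mtr g) = 0 by rewrite et' subrr.
    by rewrite b1 a0 => <-; ring.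
    by left; apply: entryP; rewrite ?h0 ?h1 ?h2 ?h3 ?a0 ?b1 ?t0; ring.
  right; apply: entryP; rewrite !entryV // -[RHS]e ?h0 ?h1 ?h2 ?h3 ?a0 ?b1 /mtr; ring.
rewrite mulf_eq0 => /orP[/eqP a0|]; last first.
  rewrite b1 mulN1r subr_eq0 => /eqP a0.
  by right; apply: entryP; rewrite !entryV // ?h0 ?h1 ?h2 ?h3 ?a0 ?b1 /mtr; ring.
have /char2[t0|/neg2 e] : mtr g + mtr g = 0.
  have: mtr g - (2 * a + b * mtr g) = 0 by rewrite et' subrr.
  by rewrite b1 a0 => <-; ring.
  have {}t0 : m00 g = - m11 g by apply/eqP; rewrite -addr_eq0; apply/eqP.
  by right; apply: entryP; rewrite !entryV // ?h0 ?h1 ?h2 ?h3 ?a0 ?b1 ?t0; ring.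
by left; apply: entryP; rewrite ?h0 ?h1 ?h2 ?h3 ?a0 ?b1 -[RHS]e; ring.
Qed.

(** A companion matrix of X^2 - t X + 1. The parameter d, up to squares, can separate SL_2-classes
    within one GL_2-class. *)
Definition comp (t d : F) : GL2 F := gl2 0 (- d^-1) d t.

Lemma comp_det (t d : F) : d != 0 -> 0 * t - (- d^-1) * d = 1.
Proof. by move=> d0; rewrite mul0r mulNr mulVf // opprK add0r. Qed.

(* For v = (X, Y), the conjugating matrix has columns v and g v / d, where
   d = det (v | g v). *)
Lemma conj_comp g (X Y : F) :
  let d := m10 g * X ^+ 2 + (m11 g - m00 g) * (X * Y) - m01 g * Y ^+ 2 in
  g \in G -> d != 0 -> exists2 M, M \in G & (g ^ M)%g = comp (mtr g) d.
Proof.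
move=> d gG d0; have dg := SLdet gG.
pose p := m00 g * X + m01 g * Y; pose q := m10 g * X + m11 g * Y.
have e : X * (q / d) - (p / d) * Y = 1.
  by rewrite -[RHS](divff d0) /p /q /d; field.
have eM := gl2E e; have MG := gl2_SL e; move: (gl2 _ _ _ _) eM MG => M eM MG.
exists M => //; have ed := comp_det (mtr g) d0.
suff E : (g * M = M * comp (mtr g) d)%g by rewrite conjgE E mulKg.
have eC := gl2E ed; rewrite -/(comp _ _) in eC; clearbody d.
apply: entryP; rewrite !entryM !eM !eC.
- by rewrite /p; field.
- transitivity ((p * mtr g - X * (m00 g * m11 g - m01 g * m10 g)) / d).
    by rewrite /p /q /mtr; field.
  by rewrite dg; field.
- by rewrite /q; field.
- transitivity ((q * mtr g - Y * (m00 g * m11 g - m01 g * m10 g)) / d).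
    by rewrite /p /q /mtr; field.
  by rewrite dg; field.
Qed.

Lemma card_fiber_ge (T T' : finType) (f : T -> T') (D : {set T}) n :
  (forall x, x \in D -> (#|[set y in D | f y == f x]| <= n)%N) ->
  (#|D| <= n * #|f @: D|)%N.
Proof.
move=> fn; rewrite -sum1_card (partition_big_imset f) /= mulnC -sum_nat_const.
apply: leq_sum => _ /imsetP[x Dx ->]; rewrite sum1dep_card.
by apply: leq_trans (fn x Dx); apply: subset_leq_card; apply/subsetP=> y; rewrite !inE.
Qed.

Lemma card_fiber_le (T T' : finType) (f : T -> T') (D : {set T}) n :
  (forall x, x \in D -> (n <= #|[set y in D | f y == f x]|)%N) ->
  (n * #|f @: D| <= #|D|)%N.
Proof.
move=> fn; rewrite -[in leqRHS]sum1_card (partition_big_imset f) /= mulnC -sum_nat_const.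
apply: leq_sum => _ /imsetP[x Dx ->]; rewrite sum1dep_card.
by apply: leq_trans (fn x Dx) _; apply: subset_leq_card; apply/subsetP=> y; rewrite !inE.
Qed.

Lemma card_sqr_fiber (D : {set F}) x : (#|[set y in D | y ^+ 2 == x ^+ 2]| <= 2)%N.
Proof.
apply: leq_trans (_ : #|[set x; -x]| <= 2)%N; last by rewrite cards2; case: eqP.
by apply: subset_leq_card; apply/subsetP=> y; rewrite !inE eqf_sqr => /andP[].
Qed.

(** Stands in for an index 2 argument, multiplicative for squares and additive for the image of x^2
    + x. *)
Lemma half_cover (T : finType) (D A B : {set T}) :
  A \subset D -> B \subset D -> [disjoint A & B] ->
  (#|D| <= 2 * #|A|)%N -> #|B| = #|A| -> D = A :|: B.
Proof.
move=> AD BD dAB le eAB; apply/esym/eqP; rewrite eqEcard subUset AD BD /=.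
by rewrite cardsU (disjoint_setI0 dAB) cards0 subn0 eAB; lia.
Qed.

Definition sqrs : {set F} := [set x ^+ 2 | x in [set~ 0 : F]].

Lemma card_sqrs : (#|F|.-1 <= 2 * #|sqrs|)%N.
Proof.
rewrite -(cardC1 (0 : F)); apply: leq_trans (card_fiber_ge (n := 2) _).
  by apply: subset_leq_card; apply/subsetP=> y; rewrite !inE.
by move=> x _; apply: card_sqr_fiber.
Qed.

(** The squares fill at least half of the nonzero elements, so together with their multiples by x
    they fill everything; y is such a multiple. *)
Lemma nonsquare_ratio (x y : F) : x != 0 -> x \notin sqrs -> y != 0 -> y \notin sqrs ->
  exists2 b, b != 0 & b ^+ 2 * x = y.
Proof.
move=> x0 xN y0 yN.
have E := @half_cover _ [set~ 0 : F] sqrs [set a * x | a in sqrs].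
have: y \in [set~ 0 : F] by rewrite !inE.
rewrite {}E.
- rewrite inE (negPf yN) => /imsetP[_ /imsetP[b] /[!inE] b0 -> ->]; by exists b.
- by apply/subsetP=> _ /imsetP[b] /[!inE] b0 ->; rewrite sqrf_eq0.
- apply/subsetP=> _ /imsetP[_ /imsetP[b] /[!inE] b0 -> ->].
  by rewrite mulf_neq0 // sqrf_eq0.
- rewrite -setI_eq0; apply/eqP/setP=> z; rewrite !inE; apply/negP => /andP[].
  case/imsetP=> a /[!inE] a0 -> /imsetP[_ /imsetP[b] /[!inE] b0 ->] e.
  case/negP: xN; apply/imsetP; exists (a / b); first by rewrite !inE mulf_neq0 // invr_eq0.
  by rewrite expr_div_n e mulrC mulKf // sqrf_eq0.
- by rewrite cardsC1 card_sqrs.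
- by apply: card_imset; apply: mulIf.
Qed.

End Lin.

(** * Normal forms under SL_2-conjugacy and commuting representatives *)

Section Conj.
Variable F : finFieldType.
Local Open Scope ring_scope.
Implicit Types (g h k : GL2 F).
Local Notation G := (SL2 F).
Local Notation Z := ('Z(G)%g).

Lemma char2_opp : (2 : F) = 0 -> forall x : F, - x = x.
Proof. by move=> e x; apply: (addIr x); rewrite addNr -mulr2n -mulr_natr e mulr0. Qed.

Lemma char2_sqrt (y : F) : (2 : F) = 0 -> exists x, x ^+ 2 = y.
Proof.
move=> e; have sqI : injective (fun x : F => x ^+ 2).
  by move=> a b /eqP; rewrite eqf_sqr char2_opp // orbb => /eqP.
by exists (invF sqI y); apply: (f_invF sqI).
Qed.

(** Pigeonhole: the values c x^2 and the values 1 - d y^2 each number more than q / 2. *)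
Lemma sum_two_squares (c d : F) : c != 0 -> d != 0 ->
  exists x y, c * x ^+ 2 + d * y ^+ 2 = 1.
Proof.
move=> c0 d0.
have n0 : 0 \notin sqrs F by apply/imsetP => -[x] /[!inE] x0 /esym/eqP; rewrite sqrf_eq0 (negPf x0).
have sq (z : F) : z \in 0 |: sqrs F -> exists x, z = x ^+ 2.
  by case/setU1P => [-> | /imsetP[x _ ->]]; [exists 0; rewrite expr0n | exists x].
pose A := [set c * z | z in 0 |: sqrs F]; pose B := [set 1 - d * z | z in 0 |: sqrs F].
have cA : #|A| = #|sqrs F|.+1 by rewrite card_imset ?cardsU1 ?n0 //; apply: mulfI.
have cB : #|B| = #|sqrs F|.+1.
  rewrite card_imset ?cardsU1 ?n0 // => x y /(addrI 1) /oppr_inj; exact: mulfI.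
have /set0Pn[_ /setIP[/imsetP[_ /sq[x ->] ->] /imsetP[_ /sq[y ->] e]]] : A :&: B != set0.
  apply/eqP=> e0; have := subset_leq_card (subsetT (A :|: B)).
  rewrite cardsU e0 cards0 subn0 cA cB cardsT; have := card_sqrs F.
  have q1 : (1 < #|F|)%N := finNzRing_gt1 F.
  by move: #|sqrs F| #|F| q1 => m q; lia.
by exists x, y; rewrite e subrK.
Qed.

(** The form is det (v | g v), whose discriminant is t^2 - 4. If c = 0 it is linear in X; in
    characteristic 2 squaring is onto; otherwise completing the square leaves a sum of two
    squares. *)
Lemma quadratic_repr1 (c e b : F) : e ^+ 2 + 4 * b * c != 0 ->
  exists X Y, c * X ^+ 2 + e * (X * Y) - b * Y ^+ 2 = 1.
Proof.
move=> nd; have [c0|c0] := eqVneq c 0.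
  have e0 : e != 0 by apply: contra nd => /eqP ->; rewrite c0 mulr0 expr0n addr0.
  by exists ((1 + b) / e), 1; rewrite c0; field.
have [z2|z2] := eqVneq (2 : F) 0.
  have [x ex] := char2_sqrt c^-1 z2.
  by exists x, 0; rewrite ex mulr0 expr0n !mulr0 addr0 subr0 divff.
have z4 : (4 : F) != 0 by rewrite -[4%N]/(2 * 2)%N natrM mulf_neq0.
have [|x [y exy]] := @sum_two_squares c (- ((e ^+ 2 + 4 * b * c) / (4 * c))) c0.
  by rewrite oppr_eq0 mulf_neq0 // invr_eq0 mulf_neq0.
exists (x - e * y / (2 * c)), y; rewrite -[RHS]exy; field. by rewrite c0 z4 z2.
Qed.

(** As det (v | g v) takes the value 1, the companion form with d = 1 is reached inside SL_2, so a
    nonparabolic trace determines the class. *)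
Lemma SL_conj_comp g : g \in G -> mtr g ^+ 2 != 4 ->
  exists2 M, M \in G & (g ^ M)%g = comp (mtr g) 1.
Proof.
move=> gG t4.
have [|X [Y eXY]] := @quadratic_repr1 (m10 g) (m11 g - m00 g) (m01 g).
  suff -> : (m11 g - m00 g) ^+ 2 + 4 * m01 g * m10 g = mtr g ^+ 2 - 4 by rewrite subr_eq0.
  by rewrite -[X in _ = _ - X]mulr1 -[X in _ = _ - _ * X](SLdet gG) /mtr; ring.
rewrite -eXY; apply: conj_comp => //; rewrite eXY; exact: oner_neq0.
Qed.

Lemma noncentral_repr g : g \in G -> g \notin Z ->
  exists X Y, m10 g * X ^+ 2 + (m11 g - m00 g) * (X * Y) - m01 g * Y ^+ 2 != 0.
Proof.
move=> gG gZ.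
have [e1|] := eqVneq (m10 g) 0; last by exists 1, 0; rewrite mulr0 !expr2 !mulr0 addr0 subr0 !mulr1.
have [e2|n2] := eqVneq (m01 g) 0; last first.
  by exists 0, 1; rewrite mul0r mulr0 expr0n mulr0 add0r expr1n mulr1 sub0r oppr_eq0.
exists 1, 1; rewrite e1 e2 !mul0r add0r subr0 !mulr1 subr_eq0.
by apply: contra gZ => /eqP e3; apply/centSLP.
Qed.

Lemma mtr_comp t d : d != 0 -> mtr (comp t d) = t :> F.
Proof. by move=> d0; rewrite /mtr !gl2E ?comp_det // add0r. Qed.

Lemma compG t d : d != 0 -> comp t d \in G.
Proof. by move=> d0; apply/gl2_SL/comp_det. Qed.

Lemma comp_sqr t d s : d != 0 -> s != 0 ->
  exists2 M, M \in G & (comp t d ^ M)%g = comp t (d * s ^+ 2).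
Proof.
move=> d0 s0; have [|//|M MG] := @conj_comp F (comp t d) s 0; first 2 last.
  - by rewrite mtr_comp // !mulr0 expr0n !mulr0 addr0 subr0 !gl2E ?comp_det // => eM; exists M.
  - exact: compG.
  - by rewrite mulr0 expr0n !mulr0 addr0 subr0 !gl2E ?comp_det // mulf_neq0 // sqrf_eq0.
Qed.

(** Take e a nonsquare if there is one and 1 otherwise: the value d = det (v | g v) matters only up
    to squares. *)
Lemma parabolic_conj : exists e : F, e != 0 /\ forall g, g \in G -> g \notin Z ->
  exists2 M, M \in G & (g ^ M)%g = comp (mtr g) 1 \/ (g ^ M)%g = comp (mtr g) e.
Proof.
have key e : e != 0 -> (forall d, d != 0 -> d \in sqrs F \/ exists2 b, b != 0 & b ^+ 2 * e = d) ->
    forall g, g \in G -> g \notin Z ->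
  exists2 M, M \in G & (g ^ M)%g = comp (mtr g) 1 \/ (g ^ M)%g = comp (mtr g) e.
  move=> e0 H g gG gZ; have [X [Y nz]] := noncentral_repr gG gZ.
  have [M MG eM] := conj_comp gG nz; set d := (_ - _) in nz eM.
  have [/imsetP[s] /[!inE] s0 ed|[s s0 ed]] := H d nz.
    have [N NG eN] := comp_sqr (mtr g) (oner_neq0 F) s0.
    exists (M * N^-1)%g; first by rewrite groupM ?groupV.
    by left; rewrite conjgM eM ed -[X in comp _ X]mul1r -eN conjgK.
  have [N NG eN] := comp_sqr (mtr g) e0 s0.
  exists (M * N^-1)%g; first by rewrite groupM ?groupV.
  by right; rewrite conjgM eM -ed mulrC -eN conjgK.
have [/existsP[e /andP[e0 eN]]|] := boolP [exists e : F, (e != 0) && (e \notin sqrs F)].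
  exists e; split=> //; apply: key => // d d0.
  have [dS|dN] := boolP (d \in sqrs F); [by left | right].
  exact: nonsquare_ratio.
rewrite negb_exists => /forallP sqA; exists 1; split; first exact: oner_neq0.
apply: key => [|d d0]; first exact: oner_neq0.
by left; have := sqA d; rewrite d0 /= negbK.
Qed.

Definition diag (l : F) : GL2 F := gl2 l 0 0 l^-1.

Lemma diag_det (l : F) : l != 0 -> l * l^-1 - 0 * 0 = 1.
Proof. by move=> l0; rewrite divff // mul0r subr0. Qed.

Lemma diagG l : l != 0 -> diag l \in G.
Proof. by move=> l0; apply/gl2_SL/diag_det. Qed.

Lemma eig_neq0 (t l : F) : l ^+ 2 - t * l + 1 = 0 -> l != 0.
Proof.
move=> e; apply/eqP => l0; move/eqP: e.
by rewrite l0 expr0n mulr0 subrr add0r oner_eq0.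
Qed.

Lemma eig_tr (t l : F) : l ^+ 2 - t * l + 1 = 0 -> t = l + l^-1.
Proof.
move=> e; have l0 := eig_neq0 e; apply: (mulIf l0); apply/eqP.
by rewrite -subr_eq0 -oppr_eq0 -[X in X == _]addr0 -{2}e; apply/eqP; field.
Qed.

Lemma mtr_diag l : l != 0 -> mtr (diag l) = l + l^-1.
Proof. by move=> l0; rewrite /mtr !gl2E ?diag_det. Qed.

Lemma split_split_comm t1 t2 : has_eig t1 -> has_eig t2 ->
  exists g h, [/\ g \in G, h \in G, mtr g = t1, mtr h = t2 & h \in 'C[g]%g].
Proof.
move=> /has_eigP[l el] /has_eigP[m em]; have [l0 m0] := (eig_neq0 el, eig_neq0 em).
exists (diag l), (diag m); rewrite !diagG // !mtr_diag // -(eig_tr el) -(eig_tr em).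
split=> //; apply/comm_entry; rewrite !gl2E ?diag_det //.
by rewrite !mul0r.
Qed.

(** The partner is sought as a + b g with g of trace t1, which leaves two equations: trace t2 and
    norm 1. *)
Lemma nonsplit_comm t1 t2 : ~~ has_eig t1 -> ~~ has_eig t2 ->
  exists g h, [/\ g \in G, h \in G, mtr g = t1, mtr h = t2 & h \in 'C[g]%g].
Proof.
move=> n1 n2.
suff [a [b [e1 e2]]] : exists a b : F, 2 * a + b * t1 = t2 /\ a ^+ 2 + a * b * t1 + b ^+ 2 = 1.
  have o := oner_neq0 F; have cd := comp_det t1 o.
  have e : a * (a + b * t1) - (- b) * b = 1 by rewrite -e2; ring.
  exists (comp t1 1), (gl2 a (- b) b (a + b * t1)).
  rewrite compG // gl2_SL // mtr_comp // {1}/mtr !gl2E //; split=> //.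
    by rewrite -e1; ring.
  by apply: (lin_cent (a := a) (b := b)); rewrite !gl2E // ?invr1; ring.
have [z2|z2] := eqVneq (2 : F) 0.
  have neg := char2_opp z2.
  have tn (t : F) : ~~ has_eig t -> t != 0.
    apply: contraNneq => ->; apply/has_eigP; exists 1.
    by rewrite mul0r subr0 expr1n -mulr2n z2.
  have [t10 t20] := (tn _ n1, tn _ n2).
  (* Artin-Schreier: for a nonsplit trace t, t^-2 avoids the image of f, an additive subgroup with
     at least half of the elements. So t1^-2 and t2^-2 lie in the same nontrivial coset. *)
  pose f (x : F) := x ^+ 2 + x.
  have fD x y : f (x + y) = f x + f y.
    by rewrite /f sqrrD -mulr_natr z2 mulr0 addr0; ring.
  have fN (t : F) : t != 0 -> ~~ has_eig t -> (t^-1) ^+ 2 \notin [set f x | x in [set: F]].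
    move=> t0; apply: contra => /imsetP[x _ ex]; apply/has_eigP; exists (t * x).
    have -> : (t * x) ^+ 2 - t * (t * x) + 1 = t ^+ 2 * (x ^+ 2 - x + (t^-1) ^+ 2) by field.
    by rewrite ex /f neg -[X in _ * (X + _)]neg addNr mulr0.
  have E := @half_cover _ [set: F] [set f x | x in [set: F]]
     [set (t1^-1) ^+ 2 + a | a in [set f x | x in [set: F]]].
  have: (t2^-1) ^+ 2 \in [set: F] by rewrite inE.
  rewrite {}E; last first.
  - by apply: card_imset; apply: addrI.
  - apply: card_fiber_ge => x _; apply: (@leq_trans #|[set x; x + 1]|); last first.
      by rewrite cards2; case: eqP.
    apply: subset_leq_card; apply/subsetP=> y; rewrite !inE /= => /eqP e.
    rewrite -[y == x]subr_eq0 -[y == x + 1]subr_eq0 -mulf_eq0.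
    have -> : (y - x) * (y - (x + 1)) = f y - f x.
      transitivity (f y - f x + 2 * (x ^+ 2 - x * y - y + x)); first by rewrite /f; ring.
      by rewrite z2 mul0r addr0.
    by rewrite e subrr.
  - rewrite -setI_eq0; apply/eqP/setP=> z; rewrite !inE; apply/negP => /andP[].
    case/imsetP=> a _ -> /imsetP[_ /imsetP[b _ ->] e].
    case/negP: (fN _ t10 n1); apply/imsetP; exists (a - b) => //.
    by rewrite neg fD e -addrA -{2}[f b]neg subrr addr0.
  - exact: subsetT.
  - exact: subsetT.
  rewrite inE (negPf (fN _ t20 n2)) => /imsetP[_ /imsetP[x _ ->] e].
  exists (t2 * x), (t2 / t1); rewrite z2 mul0r add0r divfK //; split=> //.
  have -> : (t2 * x) ^+ 2 + t2 * x * (t2 / t1) * t1 + (t2 / t1) ^+ 2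
    = t2 ^+ 2 * ((t1^-1) ^+ 2 + f x) by rewrite /f; field.
  by rewrite -e; field.
have z4 : (4 : F) != 0 by rewrite -[4%N]/(2 * 2)%N natrM mulf_neq0.
(* In odd characteristic both discriminants are nonsquares, so their ratio is some b^2, and a
   follows from the trace. *)
pose D t : F := t ^+ 2 - 4.
have DN (t : F) : ~~ has_eig t -> D t != 0 /\ D t \notin sqrs F.
  move=> n; split; first by apply: contra n => /eqP /subr0_eq; apply: parabolic_eig.
  apply: contra n => /imsetP[d _ ed]; apply/has_eigP; exists ((t + d) / 2).
  transitivity ((d ^+ 2 - D t) / 4); last by rewrite ed subrr mul0r.
  by rewrite /D; field; rewrite ?z4 ?z2.
have [b _ eb] := nonsquare_ratio (DN _ n1).1 (DN _ n1).2 (DN _ n2).1 (DN _ n2).2.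
exists ((t2 - b * t1) / 2), b; split; first by field.
transitivity ((D t2 - b ^+ 2 * D t1) / 4 + 1); first by rewrite /D; field; rewrite ?z4 ?z2.
by rewrite eb subrr mul0r add0r.
Qed.
End Conj.

(** * Centralizer partitions *)

Section CentralizerPartition.
Variables (gT : finGroupType) (G H : {group gT}).
Local Notation Z := 'Z(G).
Hypothesis comm_tr : forall g h k, g \in G -> g \notin Z -> h \in G -> k \in G ->
  h \in 'C[g] -> k \in 'C[g] -> h \in 'C[k].
Hypotheses (sHG : H \subset G) (sZH : Z \subset H).

Definition cent_supp g := class_support ('C_H[g] :\: Z) H.

Lemma cent_eq g k : g \in H -> g \notin Z -> k \in 'C_H[g] -> k \notin Z ->
  'C_H[k] = 'C_H[g].
Proof.
move=> gH gZ /setIP[kH kg] kZ; have sG x (xH : x \in H) := subsetP sHG x xH.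
apply/setP=> h; rewrite !in_setI.
have [hH|//] := boolP (h \in H); apply/idP/idP => hc.
  by apply: (comm_tr (g := k)); rewrite ?sG // cent1C.
by apply: (comm_tr (g := g)); rewrite ?sG.
Qed.

Lemma cent1J g h : h \in H -> 'C_H[g ^ h] = 'C_H[g] :^ h.
Proof. by move=> hH; rewrite conjIg conjGid // -!cent_set1 -conjg_set1 centJ. Qed.

Lemma norm_centerS : H \subset 'N(Z).
Proof. by apply: subset_trans sHG _; rewrite normal_norm ?center_normal. Qed.

Lemma notin_centerJ g h : h \in H -> (g ^ h \in Z) = (g \in Z).
Proof. by move=> hH; rewrite memJ_norm // (subsetP norm_centerS). Qed.

(** If two conjugates of C_H[g] share a noncentral element, both equal the centralizer of that
    element. *)
Lemma cent_normedTI g : g \in H -> g \notin Z ->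
  normedTI ('C_H[g] :\: Z) H 'N_H('C_H[g]).
Proof.
move=> gH gZ; apply/normedTI_P; split.
- by apply/set0Pn; exists g; rewrite in_setD gZ in_setI gH cent1id.
- rewrite subsetI subsetIl /= normsD ?subsetIr //.
  by apply: subset_trans norm_centerS; apply: subsetIl.
move=> h hH; rewrite -setI_eq0 => /set0Pn[k /setIP[/setDP[kc kZ]]].
rewrite conjDg (normP (subsetP norm_centerS h hH)) -cent1J // => /setDP[kc' _].
rewrite inE hH; apply/normP; rewrite -cent1J //.
have gjH : g ^ h \in H by rewrite groupJ.
have gjZ : g ^ h \notin Z by rewrite notin_centerJ.
by rewrite -(cent_eq gjH gjZ kc' kZ) (cent_eq gH gZ kc kZ).
Qed.

Lemma card_cent_supp g : g \in H -> g \notin Z ->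
  #|cent_supp g| = ((#|'C_H[g]| - #|Z|) * #|H : 'N_H('C_H[g])|)%N.
Proof.
move=> gH gZ; rewrite (card_support_normedTI (cent_normedTI gH gZ)) cardsD.
suff /setIidPr -> : Z \subset 'C_H[g] by [].
rewrite subsetI sZH sub_cent1; have: G \subset 'C(Z) by rewrite centsC subsetIr.
by move/subsetP; apply; apply: (subsetP sHG).
Qed.

Lemma cent_suppP g k : g \in H -> g \notin Z -> k \in cent_supp g ->
  [/\ k \in H, k \notin Z & exists2 h, h \in H & 'C_H[k] = 'C_H[g] :^ h].
Proof.
move=> gH gZ /imset2P[c h /setDP[cg cZ] hH ->].
have cH : c \in H by case/setIP: cg.
rewrite groupJ // notin_centerJ //; split=> //; exists h => //.
by rewrite cent1J // (cent_eq gH gZ).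
Qed.

Lemma cent_supp_sub g : g \in H -> g \notin Z -> cent_supp g \subset H :\: Z.
Proof.
by move=> gH gZ; apply/subsetP=> k /(cent_suppP gH gZ)[kH kZ _]; rewrite in_setD kZ.
Qed.

(** The centralizer of a common element is conjugate to both C_H[g] and C_H[k], which puts k into a
    conjugate of C_H[g]. *)
Lemma cent_supp_disjoint g k : g \in H -> g \notin Z -> k \in H -> k \notin Z ->
  k \notin cent_supp g -> [disjoint cent_supp g & cent_supp k].
Proof.
move=> gH gZ kH kZ; apply: contraR; rewrite -setI_eq0 => /set0Pn[m /setIP[]].
move=> /(cent_suppP gH gZ)[mH mZ [h hH eh]] /(cent_suppP kH kZ)[_ _ [l lH el]].
apply/imset2P.
have e : 'C_H[k] = 'C_H[g] :^ (h * l^-1) by rewrite conjsgM -eh el conjsgK.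
exists (k ^ (h * l^-1)^-1) (h * l^-1); rewrite ?groupM ?groupV ?conjgK ?conjgKV //.
rewrite in_setD notin_centerJ; last by rewrite groupV groupM ?groupV.
rewrite kZ /=.
by rewrite -mem_conjg -e in_setI kH cent1id.
Qed.

Lemma cent_supp_conj k g h : h \in H -> g ^ h \in cent_supp k -> g \in cent_supp k.
Proof.
move=> hH /imset2P[c l cD lH e]; apply/imset2P; exists c (l * h^-1) => //.
  by rewrite groupM ?groupV.
by rewrite conjgM -e conjgK.
Qed.
End CentralizerPartition.

Lemma norm_cent1J (gT : finGroupType) (H : {group gT}) g n :
  g \in H -> n \in 'N_H('C_H[g]) -> g ^ n \in 'C_H[g].
Proof. by move=> gH /setIP[_ nC]; rewrite memJ_norm // in_setI gH cent1id. Qed.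

Lemma mem_cent1J (gT : finGroupType) (g h l : gT) : (h ^ l \in 'C[g ^ l]) = (h \in 'C[g]).
Proof. by rewrite -conjg_set1 normJ memJ_conjg. Qed.

(** N and the double coset N y P are disjoint in H, and the latter has |N| |P| elements because N :^
    y meets P trivially. *)
Lemma ti_conj_index (gT : finGroupType) (H N P : {group gT}) y :
  N \subset H -> P \subset N -> y \in H -> y \notin N -> N :^ y :&: P = 1 ->
  (#|P| < #|H : N|)%N.
Proof.
move=> sNH sPN yH yN tiP; rewrite -(ltn_pmul2l (cardG_gt0 N)) Lagrange //.
have cM : #|y *: (N :^ y * P)| = (#|N| * #|P|)%N.
  by rewrite card_lcoset (TI_cardMg tiP) cardJg.
have exP g : g \in y *: (N :^ y * P) -> exists n u, [/\ n \in N, u \in P & g = n * y * u].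
  rewrite mem_lcoset => /mulsgP[_ u /imsetP[n nN ->] uP e]; exists n, u; split=> //.
  by rewrite -[LHS](mulKVg y) e conjgE -!mulgA mulKVg.
have disj : N :&: (y *: (N :^ y * P)) = set0.
  apply/setP=> g; rewrite in_set0 in_setI; apply/negP=> /andP[gN /exP[n [u [nN uP e]]]].
  case/negP: yN; have -> : y = n^-1 * g * u^-1 by rewrite e !mulgA mulgK mulVg mul1g.
  by rewrite !groupM ?groupV // (subsetP sPN).
have sub : N :|: y *: (N :^ y * P) \subset H.
  rewrite subUset sNH; apply/subsetP=> g /exP[n [u [nN uP ->]]].
  by rewrite !groupM // ?(subsetP sNH) // (subsetP sPN).
have := subset_leq_card sub; rewrite cardsU disj cards0 subn0 cM.
by apply: leq_trans; rewrite -add1n leq_add2r cardG_gt0.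
Qed.

(** * Sizes of centralizer supports *)

Section Indices.
Variables (gT : finGroupType) (G H : {group gT}).
Local Notation Z := 'Z(G).
Hypotheses (sHG : H \subset G) (sZH : Z \subset H).

(** The chain from Z through C_H[g] and its normalizer to H has three successive indices; from the
    top they are the number of conjugates, the Weyl index and the torus order modulo Z. *)
Definition supp_index g := #|H : 'N_H('C_H[g])|.
Definition weyl_index g := #|'N_H('C_H[g]) : 'C_H[g]|.
Definition torus_index g := #|'C_H[g] : Z|.

Lemma center_sub_cent g : g \in H -> Z \subset 'C_H[g].
Proof.
move=> gH; rewrite subsetI sZH sub_cent1; have: G \subset 'C(Z) by rewrite centsC subsetIr.
by move/subsetP; apply; apply: (subsetP sHG).
Qed.

Lemma cent_sub_norm g : 'C_H[g] \subset 'N_H('C_H[g]).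
Proof. by rewrite subsetI subsetIl normG. Qed.

Lemma index_factor g : g \in H ->
  #|H : Z| = (supp_index g * (weyl_index g * torus_index g))%N.
Proof.
move=> gH; rewrite /weyl_index /torus_index Lagrange_index ?cent_sub_norm ?center_sub_cent //.
rewrite Lagrange_index ?subsetIl //.
by apply: subset_trans (center_sub_cent gH) (cent_sub_norm g).
Qed.

Lemma card_cent g : g \in H -> #|'C_H[g]| = (#|Z| * torus_index g)%N.
Proof. by move=> gH; rewrite Lagrange // center_sub_cent. Qed.

Lemma torus_index_gt1 g : g \in H -> g \notin Z -> (1 < torus_index g)%N.
Proof.
move=> gH gZ; rewrite indexg_gt1; apply: contra gZ => /subsetP; apply.
by rewrite in_setI gH cent1id.
Qed.

Hypothesis comm_tr : forall g h k, g \in G -> g \notin Z -> h \in G -> k \in G ->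
  h \in 'C[g] -> k \in 'C[g] -> h \in 'C[k].

Lemma card_cent_supp_index g : g \in H -> g \notin Z ->
  #|cent_supp G H g| = (#|Z| * ((torus_index g).-1 * supp_index g))%N.
Proof.
move=> gH gZ; rewrite (card_cent_supp comm_tr sHG sZH gH gZ) card_cent //.
by rewrite -{2}[#|_|]muln1 -mulnBr subn1 mulnA.
Qed.

Lemma card_noncentral : #|H :\: Z| = (#|Z| * (#|H : Z|).-1)%N.
Proof.
have /setIidPr e := sZH; rewrite cardsD e -(Lagrange sZH).
by rewrite -{2}[#|_|]muln1 -mulnBr subn1.
Qed.

(** Disjoint supports inside H minus Z; the inequality is strict because the coset Z is missed. *)
Lemma supp_sum2 g k : g \in H -> g \notin Z -> k \in H -> k \notin Z ->
  k \notin cent_supp G H g ->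
  ((torus_index g).-1 * supp_index g + (torus_index k).-1 * supp_index k < #|H : Z|)%N.
Proof.
move=> gH gZ kH kZ kg; have dis := cent_supp_disjoint comm_tr sHG gH gZ kH kZ kg.
have := @subset_leq_card _ (cent_supp G H g :|: cent_supp G H k) (H :\: Z).
rewrite subUset !(cent_supp_sub comm_tr sHG) // => /(_ isT).
rewrite cardsU (disjoint_setI0 dis) cards0 subn0 !card_cent_supp_index // card_noncentral.
rewrite -mulnDr leq_pmul2l ?cardG_gt0 //.
have : (0 < #|H : Z|)%N by [].
by case: #|H : Z|.
Qed.

Lemma supp_sum3 g k l : g \in H -> g \notin Z -> k \in H -> k \notin Z ->
  l \in H -> l \notin Z -> k \notin cent_supp G H g ->
  l \notin cent_supp G H g -> l \notin cent_supp G H k ->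
  ((torus_index g).-1 * supp_index g + (torus_index k).-1 * supp_index k
   + (torus_index l).-1 * supp_index l < #|H : Z|)%N.
Proof.
move=> gH gZ kH kZ lH lZ kg lg lk.
have d1 := cent_supp_disjoint comm_tr sHG gH gZ kH kZ kg.
have d2 := cent_supp_disjoint comm_tr sHG gH gZ lH lZ lg.
have d3 := cent_supp_disjoint comm_tr sHG kH kZ lH lZ lk.
have := @subset_leq_card _ (cent_supp G H g :|: cent_supp G H k :|: cent_supp G H l) (H :\: Z).
rewrite !subUset !(cent_supp_sub comm_tr sHG) // => /(_ isT).
rewrite cardsU setIUl (disjoint_setI0 d2) (disjoint_setI0 d3) setU0 cards0 subn0.
rewrite cardsU (disjoint_setI0 d1) cards0 subn0.
rewrite !card_cent_supp_index // card_noncentral.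
rewrite -!mulnDr leq_pmul2l ?cardG_gt0 //.
have : (0 < #|H : Z|)%N by [].
by case: #|H : Z|.
Qed.

Lemma torus_index_eq g k : g \in H -> g \notin Z -> k \in cent_supp G H g ->
  torus_index k = torus_index g.
Proof.
move=> gH gZ kg; have [kH kZ [h hH e]] := cent_suppP comm_tr sHG gH gZ kg.
have := card_cent kH; rewrite e cardJg (card_cent gH) => /eqP.
by rewrite eqn_pmul2l ?cardG_gt0 // => /eqP.
Qed.

Lemma expg_torus_index g : g \in H -> g ^+ torus_index g \in Z.
Proof.
move=> gH; have n : 'C_H[g] \subset 'N(Z).
  by apply: subset_trans (norm_centerS sHG); apply: subsetIl.
have gC : g \in 'C_H[g] by rewrite in_setI gH cent1id.
have gN := subsetP n g gC.
apply: coset_idr; first by rewrite groupX.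
rewrite morphX //= /torus_index -card_quotient //.
by apply/eqP; rewrite -order_dvdn order_dvdG // mem_quotient.
Qed.
End Indices.

(** The fraction (a - 1) / (e a), cleared of denominators, is at least 3/8. The next three lemmas
    give 1/4 for a >= 2, then 1/2 for Weyl index 1, and 3/4 for Weyl index 1 with a >= 4. *)
Lemma weight_torus n e a h : (0 < e <= 2)%N -> (4 <= a)%N -> h = (n * (e * a))%N ->
  (3 * h <= 8 * (a.-1 * n))%N.
Proof.
case: a => [|[|[|[|a]]]] // /andP[e0 e2] _ -> /=.
have /orP[/eqP->|/eqP->] : (e == 1%N) || (e == 2%N) by case: e e0 e2 => [|[|[|]]].
  by rewrite mul1n; move: (n * a)%N (mulnDr n a 4) => m; lia.
by lia.
Qed.

Lemma weight_small_torus n e a : (0 < e <= 2)%N -> (1 < a)%N ->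
  (n * (e * a) <= 4 * (a.-1 * n))%N.
Proof.
move=> /andP[e0 e2]; case: a => [|[|a]] // _ /=.
have : (n * (e * a.+2) <= n * (2 * a.+2))%N by rewrite leq_mul2l leq_mul2r e2 !orbT.
by move/leq_trans; apply; rewrite [(a.+1 * n)%N]mulnC !mulnA [(n * 2)%N]mulnC [(4 * n)%N]mulnC mulnAC; lia.
Qed.

Lemma weight_unipotent n a : (1 < a)%N -> (n * (1 * a) <= 2 * (a.-1 * n))%N.
Proof. by case: a => [|[|a]] // _ /=; lia. Qed.

Lemma weight_torus1 n a : (4 <= a)%N -> (3 * (n * (1 * a)) <= 4 * (a.-1 * n))%N.
Proof. by case: a => [|[|[|[|a]]]] // _ /=; lia. Qed.

Lemma one_or_two e : (0 < e <= 2)%N -> e = 1%N \/ e = 2%N.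
Proof. by case: e => [|[|[|]]] // _; [left | right]. Qed.

(** As fractions of h, 3/8 + 3/8 + 1/4 already reaches 1; in the next lemma 3/4 + 3/8 exceeds it. *)
Lemma weights3 h a b c : (3 * h <= 8 * a)%N -> (3 * h <= 8 * b)%N ->
  (h <= 4 * c)%N -> (a + b + c < h)%N -> False.
Proof. lia. Qed.

Lemma weights2 h a b : (3 * h <= 4 * a)%N -> (3 * h <= 8 * b)%N ->
  (a + b < h)%N -> False.
Proof. lia. Qed.

(** With Weyl index 2 a support takes h / 2 cosets of Z less one per conjugate, so two of them miss
    m + n >= 2 cosets, where only one may be missed. *)
Lemma two_tori a b m n : (4 <= a)%N -> (4 <= b)%N -> (0 < m)%N -> (0 < n)%N ->
  (m * (2 * a) = n * (2 * b))%N ->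
  ((m * (2 * a)).-1 <= a.-1 * m + b.-1 * n)%N -> False.
Proof.
case: a b => [|a] // [|b] // _ _ m0 n0 /=; rewrite !mulnS !mulnA ![(_ * 2)%N]mulnC.
rewrite -!mulnA ![(a * _)%N]mulnC ![(b * _)%N]mulnC.
by move: (m * a)%N (n * b)%N => u v; lia.
Qed.

(** * Weights of the blocks of x, y and further elements *)

Section SL2.
Variables (F : finFieldType) (H : {group GL2 F}).
Local Open Scope ring_scope.
Implicit Types (g h k : GL2 F).
Local Notation G := (SL2 F).
Local Notation Z := ('Z(G)%g).
Hypotheses (sHG : H \subset G) (sZH : Z \subset H).
Local Notation cs := (cent_supp G H).
Local Notation ti := (torus_index G H).
Local Notation wi := (weyl_index H).
Local Notation si := (supp_index H).

Lemma SL_comm_tr g h k : g \in G -> g \notin Z -> h \in G -> k \in G ->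
  h \in 'C[g]%g -> k \in 'C[g]%g -> h \in 'C[k]%g.
Proof. by move=> gG gZ _ _; apply: comm_trans. Qed.

Lemma parabolicZ g : g \in G -> mtr g ^+ 2 != 4 -> g \notin Z.
Proof.
move=> gG; apply: contra => gZ; case/centSLP: (gZ) => // e1 e2 e3.
have := SLdet gG; rewrite /mtr e1 e2 e3 mul0r subr0 => e.
by apply/eqP; transitivity (4 * (m11 g * m11 g)); [ring | rewrite e mulr1].
Qed.

(** A normalizing element sends g to an element of C_H[g] with the same trace, so to g or g^-1, and
    the index counts these images. *)
Lemma weyl_index_le2 g : g \in H -> mtr g ^+ 2 != 4 -> (0 < wi g <= 2)%N.
Proof.
move=> gH t4; have gG := subsetP sHG g gH; have gZ := parabolicZ gG t4.
rewrite /weyl_index; set N := 'N_H('C_H[g])%g.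
have -> : 'C_H[g]%g = 'C_N[g]%g.
  apply/eqP; rewrite eqEsubset; apply/andP; split; last by apply: setSI; apply: subsetIl.
  by rewrite subsetI subsetIr andbT; apply: cent_sub_norm.
rewrite index_cent1 (_ : _ && _ = (#|g ^: N| <= 2)%N)%g; last first.
  by rewrite andb_idl // => _; apply/card_gt0P; exists g; apply: class_refl.
apply: (@leq_trans #|[set g; g^-1%g]|); last by rewrite cards2; case: eqP.
apply: subset_leq_card; apply/subsetP=> _ /imsetP[n nN ->].
have [nH nC] := setIP nN; have nG := subsetP sHG n nH.
have: (g ^ n)%g \in 'C_H[g]%g by rewrite memJ_norm // in_setI gH cent1id.
case/setIP=> _ gnc; apply/set2P.
by apply: comm_same_trace => //; [rewrite groupJ | rewrite mtrJ].
Qed.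

Lemma cs_type g k : g \in H -> g \notin Z -> k \in cs g ->
  ((mtr k ^+ 2 == 4) = (mtr g ^+ 2 == 4)) * (has_eig (mtr k) = has_eig (mtr g)).
Proof.
move=> gH gZ /imset2P[c h /setDP[/setIP[cH cc] cZ] hH ->].
rewrite mtrJ ?(subsetP sHG) //; apply: comm_type => //; exact: (subsetP sHG).
Qed.

Variables x y : GL2 F.
Hypotheses (xH : x \in H) (yH : y \in H) (tx : mtr x ^+ 2 != 4).
Hypotheses (sx : has_eig (mtr x)) (nsy : ~~ has_eig (mtr y)).
Hypotheses (ax : (4 <= ti x)%N) (ay : (4 <= ti y)%N).

Let xG : x \in G. Proof. exact: (subsetP sHG). Qed.
Let yG : y \in G. Proof. exact: (subsetP sHG). Qed.
Let xZ : x \notin Z. Proof. exact: parabolicZ. Qed.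
Let ty : mtr y ^+ 2 != 4.
Proof. by apply: contra nsy => /eqP; apply: parabolic_eig. Qed.
Let yZ : y \notin Z. Proof. exact: parabolicZ. Qed.

Let yx : y \notin cs x.
Proof. by apply: contra nsy => /(cs_type xH xZ) ->. Qed.

Let wx := weight_torus (weyl_index_le2 xH tx) ax (index_factor sHG sZH xH).
Let wy := weight_torus (weyl_index_le2 yH ty) ay (index_factor sHG sZH yH).

(** An element outside both supports would add a third block of fraction 1/4. *)
Lemma semisimple_cover g : g \in H -> mtr g ^+ 2 != 4 -> g \in cs x :|: cs y.
Proof.
move=> gH tg; apply/negPn/negP; rewrite in_setU negb_or => /andP[gx gy].
have gZ := parabolicZ (subsetP sHG g gH) tg.
have := supp_sum3 sHG sZH SL_comm_tr xH xZ yH yZ gH gZ yx gx gy.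
have := torus_index_gt1 gH gZ; have := weyl_index_le2 gH tg.
move: (index_factor sHG sZH gH) wx wy.
move: #|_ : _| (wi g) (ti g) (si g) => h e a n -> vx vy /andP[e0 e2] a2 le.
have vg := weight_small_torus n (introT andP (conj e0 e2)) a2.
exact: weights3 vx vy vg le.
Qed.

(** Weyl index 1 would give x the fraction 3/4, too much beside 3/8 for y. *)
Lemma weyl_index_split : wi x = 2%N.
Proof.
have := supp_sum2 sHG sZH SL_comm_tr xH xZ yH yZ yx.
have := weyl_index_le2 xH tx; move: (index_factor sHG sZH xH) wy ax.
move: #|_ : _| (wi x) (ti x) (si x) => h e a n -> vy a4 /one_or_two[E|//] le.
rewrite E in vy le.
by have := weights2 (weight_torus1 n a4) vy le.
Qed.

Lemma weyl_index_nonsplit : wi y = 2%N.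
Proof.
have := supp_sum2 sHG sZH SL_comm_tr xH xZ yH yZ yx.
have := weyl_index_le2 yH ty; move: (index_factor sHG sZH yH) wx ay.
move: #|_ : _| (wi y) (ti y) (si y) => h e a n -> vx a4 /one_or_two[E|//] le.
rewrite E addnC in vx le.
by have := weights2 (weight_torus1 n a4) vx le.
Qed.

(** A self-normalizing C_H[w] would have a block of at least half of H, beside two of at least
    3/8. *)
Lemma parabolic_normalizer w : w \in H -> w \notin Z -> mtr w ^+ 2 = 4 ->
  exists2 b : GL2 F, b \in 'N_H('C_H[w])%g & b \notin 'C[w]%g.
Proof.
move=> wH wZ tw.
have [nC|/subsetPn[b bN bC]] := boolP ('N_H('C_H[w]) \subset 'C_H[w])%g; last first.
  exists b => //; apply: contra bC => bC.
  by rewrite in_setI bC; case/setIP: bN => ->.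
have e1 : wi w = 1%N by apply/eqP; rewrite indexg_eq1.
have notin g : g \in H -> g \notin Z -> mtr g ^+ 2 != 4 -> w \notin cs g.
  by move=> gH gZ tg; apply: contra tg => /(cs_type gH gZ)[<- _]; rewrite tw.
have := supp_sum3 sHG sZH SL_comm_tr xH xZ yH yZ wH wZ yx (notin _ xH xZ tx) (notin _ yH yZ ty).
have := torus_index_gt1 wH wZ.
move: (index_factor sHG sZH wH) wx wy; rewrite e1.
move: #|_ : _| (ti w) (si w) => h a n -> vx vy a2 le.
have vw := weight_unipotent n a2.
case: (weights3 vx vy _ le); apply: leq_trans vw _; exact: leq_mul.
Qed.

Lemma parabolic_exists : exists w : GL2 F, [/\ w \in H, w \notin Z & mtr w ^+ 2 = 4].
Proof.
have [/existsP[w /and3P[wH wZ /eqP tw]]|] :=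
  boolP [exists w, [&& w \in H, w \notin Z & mtr w ^+ 2 == 4]]; first by exists w.
rewrite negb_exists => /forallP now.
have cov : (H :\: Z \subset cs x :|: cs y)%g.
  apply/subsetP=> g /setDP[gH gZ]; apply: semisimple_cover => //.
  by have := now g; rewrite gH gZ.
have := subset_leq_card cov; rewrite card_noncentral //.
have dis := cent_supp_disjoint SL_comm_tr sHG xH xZ yH yZ yx.
rewrite cardsU (disjoint_setI0 dis) cards0 subn0 !card_cent_supp_index //;
  try exact: SL_comm_tr.
rewrite -mulnDr leq_pmul2l ?cardG_gt0 //.
have := index_factor sHG sZH yH; rewrite (index_factor sHG sZH xH).
rewrite weyl_index_split weyl_index_nonsplit.
have n1 : (0 < si x)%N := indexg_gt0 _ _.
have n2 : (0 < si y)%N := indexg_gt0 _ _.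
by move=> e1 e2; case: (two_tori ax ay n1 n2 e1 e2).
Qed.
End SL2.

(** * Borel subgroups *)

Section Coord.
Variables (F : finFieldType).
Local Open Scope ring_scope.
Implicit Types (g h k : GL2 F).
Local Notation G := (SL2 F).
Local Notation Z := ('Z(G)%g).

Definition upper_unip : {set GL2 F} := [set g in G | (m10 g == 0) && (m00 g == 1)].

Lemma upper_unipP g : reflect [/\ g \in G, m10 g = 0, m00 g = 1 & m11 g = 1] (g \in upper_unip).
Proof.
rewrite [g \in upper_unip]in_set; apply: (iffP and3P) => [[gG /eqP e1 /eqP e0] | [-> -> -> _] //]; split=> //.
by have := SLdet gG; rewrite e1 e0 mulr0 subr0 mul1r.
Qed.

Lemma upper_unip_group_set : group_set upper_unip.
Proof.
apply/group_setP; split; first by apply/upper_unipP; rewrite group1 !entry1.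
move=> g h /upper_unipP[gG g1 g0 g2] /upper_unipP[hG h1 h0 h2].
apply/upper_unipP; rewrite groupM // !entryM g0 g1 g2 h0 h1 h2.
by split=> //; ring.
Qed.
Canonical upper_unip_group := Group upper_unip_group_set.

Definition diagonal : {set GL2 F} := [set g in G | (m10 g == 0) && (m01 g == 0)].

Lemma diagonalP g : reflect [/\ g \in G, m10 g = 0 & m01 g = 0] (g \in diagonal).
Proof.
by rewrite [g \in diagonal]in_set; apply: (iffP and3P) => [[gG /eqP e1 /eqP e0] | [-> -> ->]].
Qed.

Lemma diagonal_group_set : group_set diagonal.
Proof.
apply/group_setP; split; first by apply/diagonalP; rewrite group1 !entry1.
move=> g h /diagonalP[gG g1 g0] /diagonalP[hG h1 h0].
apply/diagonalP; rewrite groupM // !entryM g0 g1 h0 h1.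
by split=> //; ring.
Qed.
Canonical diagonal_group := Group diagonal_group_set.

Lemma unip_det (v : F) : 1 * 1 - v * 0 = 1.
Proof. by rewrite mulr1 mulr0 subr0. Qed.

Lemma card_upper_unip : #|upper_unip| = #|F|.
Proof.
have <- : #|[set gl2 1 v 0 1 | v in [set: F]]| = #|F|.
  rewrite card_imset ?cardsT // => u v e.
  by have := congr1 (@m01 F) e; rewrite !gl2E // unip_det.
congr #|pred_of_set _|; apply/setP=> g; apply/upper_unipP/imsetP => [[gG e1 e0 e2] | [v _ ->]].
  by exists (m01 g) => //; apply: entryP; rewrite !gl2E ?unip_det.
by rewrite gl2_SL ?gl2E ?unip_det.
Qed.

Lemma card_diagonal : #|diagonal| = #|F|.-1.
Proof.
rewrite -(cardsC1 (0 : F)).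
have dI : {in [set~ 0 : F] &, injective (@diag F)}.
  move=> u v; rewrite !inE => u0 v0 e.
  by have := congr1 (@m00 F) e; rewrite !gl2E ?diag_det.
rewrite -(card_in_imset dI).
congr #|pred_of_set _|; apply/setP=> g; apply/diagonalP/imsetP => [[gG e1 e0] | [v]].
  have e := SLdet gG; rewrite e1 mulr0 subr0 in e.
  have l0 : m00 g != 0 by apply/eqP=> l0; move/eqP: e; rewrite l0 mul0r eq_sym oner_eq0.
  exists (m00 g); first by rewrite !inE.
  by apply: entryP; rewrite !gl2E ?diag_det //; apply: (mulfI l0); rewrite divff.
move=> vD ->; have v0 : v != 0 by rewrite !inE in vD.
by rewrite diagG ?gl2E ?diag_det.
Qed.

Lemma center_diag g : g \in Z -> g \in diagonal.
Proof.
move=> gZ; have gG : g \in G := subsetP (center_sub _) g gZ.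
by case/centSLP: gZ => // e1 e2 _; apply/diagonalP.
Qed.

Lemma centerX2 g : g \in Z -> (g ^+ 2)%g = 1%g.
Proof.
move=> gZ; have gG : g \in G := subsetP (center_sub _) g gZ.
case/centSLP: gZ => // e1 e2 e3; have := SLdet gG; rewrite e1 e2 e3 mul0r subr0 => e.
by rewrite expgS expg1; apply: entryP; rewrite entryM entry1 ?e3 ?e1 ?e2 ?e; ring.
Qed.

Lemma scalar_center (s : F) : s ^+ 2 = 1 ->
  exists2 c, c \in Z & [/\ m00 c = s, m01 c = 0, m10 c = 0 & m11 c = s].
Proof.
move=> e; have e1 : s * s - 0 * 0 = 1 by rewrite mul0r subr0.
by exists (gl2 s 0 0 s); rewrite ?gl2E //; apply/centSLP; rewrite ?gl2_SL ?gl2E.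
Qed.

(** Multiplying z on both sides by unipotents reaches every g in SL_2 with the same nonzero lower
    left entry. Conjugating unipotents by an antidiagonal element supplies all nonzero values of
    that entry, and a lower unipotent factor disposes of the value 0. *)
Lemma upper_unip_generate (H : {group GL2 F}) y :
  H \subset G -> upper_unip \subset H -> y \in H -> m10 y != 0 -> H :=: G.
Proof.
move=> sHG sUH yH y10; apply/eqP; rewrite eqEsubset sHG /=.
pose u v : GL2 F := gl2 1 v 0 1.
have uE v : (m00 (u v) = 1) * (m01 (u v) = v) * (m10 (u v) = 0) * (m11 (u v) = 1).
  by rewrite /u !gl2E ?unip_det.
have uH v : u v \in H.
  by apply: (subsetP sUH); apply/upper_unipP; rewrite !uE gl2_SL ?unip_det.
have yG := subsetP sHG y yH.
have big z g : z \in H -> m10 z != 0 -> g \in G -> m10 g = m10 z -> g \in H.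
  move=> zH z10 gG e10.
  suff -> : g = (u ((m00 g - m00 z) / m10 z)%R * z * u ((m11 g - m11 z) / m10 z)%R)%g.
    by rewrite !groupM.
  have ez := SLdet (subsetP sHG z zH); have eg := SLdet gG.
  apply: entryP; rewrite !entryM !uE.
  - by field.
  - apply: (mulIf z10).
    transitivity (m00 g * m11 g - 1); first by rewrite -[X in _ - X]eg e10; ring.
    by rewrite -[X in _ - X]ez; field.
  - by rewrite e10; ring.
  - by field.
have wdet : 0 * 0 - (- (m10 y)^-1) * m10 y = 1 by field.
pose w := gl2 0 (- (m10 y)^-1) (m10 y) 0.
have wH : w \in H by apply: (big y); rewrite ?gl2_SL ?gl2E.
have all10 g : g \in G -> m10 g != 0 -> g \in H.
  move=> gG g10; have gV : (u (- m10 g / m10 y ^+ 2)%R ^ w)%g \in H by rewrite groupJ.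
  have e : m10 (u (- m10 g / m10 y ^+ 2)%R ^ w)%g = m10 g.
    by rewrite conjgE !entryM !entryV ?gl2_SL // !gl2E // ?uE; field.
  by apply: (big _ _ gV) => //; rewrite e.
apply/subsetP=> g gG; have [g10|] := eqVneq (m10 g) 0; last exact: all10.
have ldet : 1 * 1 - 0 * 1 = 1 :> F by ring.
have lG := gl2_SL ldet.
rewrite -(mulgK (gl2 1 0 1 1) g) groupM ?groupV //; last first.
  by apply: all10; rewrite ?gl2E // oner_neq0.
apply: all10; first by rewrite groupM.
rewrite entryM !gl2E // g10 mul0r add0r mulr1.
apply/eqP=> g11; have := SLdet gG; rewrite g10 g11 !mulr0 subr0 => /eqP.
by rewrite eq_sym oner_eq0.
Qed.

Lemma tr_parabolic g : g \in G -> mtr g ^+ 2 - 4 = (m00 g - m11 g) ^+ 2 + 4 * (m01 g * m10 g).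
Proof. by move=> gG; rewrite /mtr -[X in _ - X]mulr1 -[X in _ - _ * X](SLdet gG); ring. Qed.

Lemma upper_conj g : g \in G -> has_eig (mtr g) -> exists2 M, M \in G & m10 (g ^ M)%g = 0.
Proof.
move=> gG /has_eigP[l el]; have [e|c0] := eqVneq (m10 g) 0.
  by exists 1%g; rewrite ?group1 // conjg1.
have eM : (l - m11 g) * 0 - (- (m10 g)^-1) * m10 g = 1 by field.
(* The first column is an eigenvector of g for l. *)
exists (gl2 (l - m11 g) (- (m10 g)^-1) (m10 g) 0); first exact: gl2_SL.
rewrite conjgE !entryM !entryV ?gl2_SL // !gl2E //.
transitivity (m10 g * (l ^+ 2 - mtr g * l + (m00 g * m11 g - m01 g * m10 g))).
  by rewrite /mtr; ring.
by rewrite (SLdet gG) el mulr0.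
Qed.

Lemma upper_coords u d : u \in G -> m10 u = 0 -> m00 u = m11 u -> m01 u != 0 -> d \in G ->
  (u ^ d)%g \in 'C[u]%g -> d \notin 'C[u]%g ->
  exists2 M, M \in G & [/\ m10 (u ^ M)%g = 0, m00 (u ^ M)%g = m11 (u ^ M)%g &
     m01 (u ^ M)%g != 0] /\ [/\ m10 (d ^ M)%g = 0, m01 (d ^ M)%g = 0
     & m00 (d ^ M)%g != m11 (d ^ M)%g].
Proof.
move=> uG u10 u0011 u01 dG /comm_entry[e1 _ _] dC.
have d10 : m10 d = 0.
  have /eqP : m01 u * (m01 u * (m10 d * m10 d)) = 0.
    rewrite -[RHS]oppr0 -[in RHS](mulr0 (m01 (u ^ d)%g)) -[in RHS]u10 e1.
    by rewrite conjgE !entryM !entryV // u10 u0011; ring.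
  by rewrite !mulf_eq0 (negPf u01) orbb => /eqP.
have d0011 : m00 d - m11 d != 0.
  apply: contra dC; rewrite subr_eq0 => /eqP e; apply/comm_entry.
  by rewrite u10 u0011 d10 e !subrr !mulr0.
(* This shear moves the second eigenline of d to a coordinate axis and keeps the first. *)
pose s := - (m01 d / (m00 d - m11 d)).
have VG : gl2 1 s 0 1 \in G by rewrite gl2_SL ?unip_det.
exists (gl2 1 s 0 1) => //.
rewrite !conjgE !entryM !entryV // !gl2E ?unip_det // u10 d10 u0011; split; split.
- by ring.
- by ring.
- by rewrite (_ : _ + _ = m01 u) //; ring.
- by ring.
- by rewrite /s; field.
- rewrite -subr_eq0 (_ : _ - _ = m00 d - m11 d) //; ring.
Qed.

(** Since c carries g into its own centralizer without commuting with it, c fixes the eigenline of g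
    and has a second one. In a basis adapted to both lines g is upper triangular and c diagonal. *)
Lemma borel_coords g c : g \in G -> g \notin Z -> mtr g ^+ 2 = 4 -> c \in G ->
  (g ^ c)%g \in 'C[g]%g -> c \notin 'C[g]%g ->
  exists2 M, M \in G & [/\ m10 (g ^ M)%g = 0, m00 (g ^ M)%g = m11 (g ^ M)%g &
     m01 (g ^ M)%g != 0] /\ [/\ m10 (c ^ M)%g = 0, m01 (c ^ M)%g = 0
     & m00 (c ^ M)%g != m11 (c ^ M)%g].
Proof.
move=> gG gZ tg cG gc cc; have [M MG u10] := upper_conj gG (parabolic_eig tg).
have gMG : (g ^ M)%g \in G by rewrite groupJ.
have u0011 : m00 (g ^ M)%g = m11 (g ^ M)%g.
  have := tr_parabolic gMG; rewrite mtrJ // tg subrr u10 !mulr0 addr0 => /esym/eqP.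
  by rewrite sqrf_eq0 subr_eq0 => /eqP.
have u01 : m01 (g ^ M)%g != 0.
  apply: contra gZ => /eqP u01; rewrite -(memJ_norm _ (_ : M \in 'N(Z)%g)).
    by apply/centSLP.
  by apply: (subsetP (normal_norm (center_normal _))).
have [|||V VG [uV dV]] := upper_coords gMG u10 u0011 u01 (d := (c ^ M)%g).
- by rewrite groupJ.
- by rewrite -conjJg -conjg_set1 normJ memJ_conjg.
- by rewrite -conjg_set1 normJ memJ_conjg.
by exists (M * V)%g; rewrite ?groupM // !conjgM.
Qed.

Lemma normalizer_split g c : g \in G -> g \notin Z -> mtr g ^+ 2 = 4 -> c \in G ->
  (g ^ c)%g \in 'C[g]%g -> c \notin 'C[g]%g -> mtr c ^+ 2 != 4 /\ has_eig (mtr c).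
Proof.
move=> gG gZ tg cG gc cc.
have [M MG [_ [e1 e2 e3]]] := borel_coords gG gZ tg cG gc cc.
have cMG : (c ^ M)%g \in G by rewrite groupJ.
rewrite -(mtrJ c MG) -subr_eq0 tr_parabolic // e1 !mulr0 addr0 sqrf_eq0 subr_eq0; split=> //.
have := SLdet cMG; rewrite e1 mulr0 subr0 => e; apply/has_eigP; exists (m00 (c ^ M)%g).
by rewrite -e /mtr; ring.
Qed.
End Coord.

(** * Subgroups containing a split and a nonsplit torus *)

(** For w >= k + 4 the right side is too large and for w <= k + 2 too small. *)
Lemma order_equation (k n w : nat) : (1 < k)%N -> (k + 2 < n)%N ->
  (n * ((k + 2) * (k + 1)) = w * (2 + k * n))%N -> w = (k + 3)%N.
Proof.
move=> k2 nk e; apply/eqP; rewrite eqn_leq; apply/andP; split; rewrite leqNgt; apply/negP => lt.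
  have l1 : ((k + 4) * (2 + k * n) <= w * (2 + k * n))%N by rewrite leq_mul2r; apply/orP; right; lia.
  have l2 : (2 * n <= k * n)%N by rewrite leq_mul2r k2 orbT.
  move: l1; rewrite -e => l1; nia.
have l1 : (w * (2 + k * n) <= (k + 2) * (2 + k * n))%N by rewrite leq_mul2r; apply/orP; right; lia.
move: l1; rewrite -e => l1.
have l2 : ((k + 2) * 3 <= (k + 2) * n)%N by rewrite leq_mul2l; apply/orP; right; lia.
nia.
Qed.

(* Here h = |H : Z|; m, n and r are the numbers of H-conjugates of the split torus
   (of order a modulo Z), of the nonsplit torus (of order c modulo Z) and of the
   unipotent subgroup (of order Q), whose normalizers have order 2a, 2c and aQ
   modulo Z. *)
Lemma class_equation (a c h m n r Q s : nat) :
  (4 <= a)%N -> (4 <= c)%N -> (1 < Q)%N -> (Q < r)%N ->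
  h = (m * (2 * a))%N -> h = (n * (2 * c))%N -> h = (r * (a * Q))%N ->
  h.-1 = (a.-1 * m + c.-1 * n + Q.-1 * r)%N -> Q.-1 = (s * a)%N ->
  (s <= 2)%N /\ (s * c = Q.+1)%N.
Proof.
move=> a4 c4 Q1 Qr e1 e2 e3 e4 es.
have s0 : (0 < s)%N by case: s es => //; lia.
have Q5 : (5 <= Q)%N by have := leq_pmull a s0; lia.
have em : (2 * m = r * Q)%N.
  have /(introT eqP) : (m * 2 * a = r * Q * a)%N.
    by rewrite -mulnA -e1 e3 -mulnA [(Q * a)%N]mulnC.
  by rewrite eqn_pmul2r; [move/eqP => <-; rewrite mulnC | lia].
have h0 : (0 < h)%N by rewrite e3 !muln_gt0; apply/and3P; split; lia.
(* Halving h = 2am and h = 2cn turns the class equation into m + n = 1 + (Q - 1) r, and 2m = rQ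
   eliminates m. *)
have en : (2 * n = 2 + (Q - 2) * r)%N.
  have f1 : (2 * (a.-1 * m) + 2 * m = h)%N by rewrite e1 -mulnDr -mulSnr prednK; lia.
  have f2 : (2 * (c.-1 * n) + 2 * n = h)%N by rewrite e2 -mulnDr -mulSnr prednK; lia.
  have f3 : (Q.-1 * r = (Q - 2) * r + r)%N by rewrite -mulSnr; congr (_ * _)%N; lia.
  have f4 : (r * Q = (Q - 2) * r + 2 * r)%N by rewrite -mulnDl mulnC; congr (_ * _)%N; lia.
  lia.
have ew : (s * c)%N = (Q - 2 + 3)%N.
  apply: (@order_equation _ r); [lia | lia |].
  have -> : (Q - 2 + 2 = Q)%N by lia.
  have -> : (Q - 2 + 1 = s * a)%N by lia.
  rewrite -en; transitivity (s * h)%N; first by rewrite e3; ring.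
  by rewrite e2; ring.
split; last lia.
(* The multiples s a = Q - 1 and s c = Q + 1 differ by 2, but by at least s as a < c. *)
rewrite leqNgt; apply/negP => s3.
have ac : (a < c)%N by rewrite -(ltn_pmul2l s0); lia.
have := leq_mul (leqnn s) ac; rewrite mulnS; lia.
Qed.

(** * The class equation with w upper triangular and b diagonal *)

Section Core.
Variables (F : finFieldType) (H : {group GL2 F}).
Local Open Scope ring_scope.
Implicit Types (g h k : GL2 F).
Local Notation G := (SL2 F).
Local Notation Z := ('Z(G)%g).
Hypotheses (sHG : H \subset G) (sZH : Z \subset H).
Local Notation cs := (cent_supp G H).
Local Notation ti := (torus_index G H).
Local Notation wi := (weyl_index H).
Local Notation si := (supp_index H).
Variables b w y : GL2 F.
Hypotheses (wH : w \in H) (w10 : m10 w = 0) (w0011 : m00 w = m11 w) (w01 : m01 w != 0).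
Hypotheses (bH : b \in H) (b10 : m10 b = 0) (b01 : m01 b = 0) (b0011 : m00 b != m11 b).
Hypotheses (yH : y \in H) (nsy : ~~ has_eig (mtr y)).
Hypotheses (ab : (4 <= ti b)%N) (ay : (4 <= ti y)%N).

Local Notation P := (H :&: upper_unip F)%g.
Local Notation T := (H :&: diagonal F)%g.
Local Notation N := ('N_H('C_H[w]))%g.

Let HG g : g \in H -> g \in G. Proof. exact: (subsetP sHG). Qed.

Let bZ : b \notin Z.
Proof. by apply: contra b0011 => /centSLP[|_ _ ->] //; apply: HG. Qed.

Let wZ : w \notin Z.
Proof. by apply: contra w01 => /centSLP[|-> _ _] //; apply: HG. Qed.

Let b0 : b \in G := HG bH.
Let sub0 : m00 b - m11 b != 0. Proof. by rewrite subr_eq0. Qed.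

Lemma tb : mtr b ^+ 2 != 4.
Proof. by rewrite -subr_eq0 tr_parabolic // b10 !mulr0 addr0 sqrf_eq0. Qed.

Lemma sb : has_eig (mtr b).
Proof.
have := SLdet b0; rewrite b01 mul0r subr0 => e; apply/has_eigP; exists (m00 b).
by rewrite -e /mtr; ring.
Qed.

Let yG := HG yH.
Let yZ : y \notin Z.
Proof. by apply: parabolicZ => //; apply: contra nsy => /eqP; apply: parabolic_eig. Qed.

Lemma y10 : m10 y != 0.
Proof.
apply: contra nsy => /eqP e; have := SLdet yG; rewrite e mulr0 subr0 => e1.
by apply/has_eigP; exists (m00 y); rewrite -e1 /mtr; ring.
Qed.

Lemma cent_b : 'C_H[b]%g = T.
Proof.
apply/setP=> g; rewrite !in_setI; have [gH|//] := boolP (g \in H).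
apply/comm_entry/diagonalP => [[_ e1 e2] | [_ e1 e2]]; last first.
  by rewrite e1 e2 b01 b10 !mul0r.
split; first exact: HG.
  by apply: (mulIf sub0); rewrite e2 b10 !mul0r.
by apply: (mulIf sub0); rewrite e1 b01 !mul0r.
Qed.

Let bC : b \in 'C_H[b]%g. Proof. by apply/setIP; split=> //; apply: cent1id. Qed.

Lemma cent_wP g : reflect [/\ g \in H, m10 g = 0 & m00 g = m11 g] (g \in 'C_H[w]%g).
Proof.
rewrite in_setI; apply: (iffP andP) => [[gH /comm_entry[e1 e2 _]] | [gH e1 e2]].
  split=> //; first by apply: (mulfI w01); rewrite -e1 w10 !mulr0.
  by apply/eqP; rewrite -subr_eq0; apply/eqP/(mulfI w01); rewrite -e2 w0011 subrr !mulr0.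
split=> //; apply/comm_entry; rewrite e1 e2 w10 w0011 !subrr; split; ring.
Qed.

Lemma norm_wP g : reflect (g \in H /\ m10 g = 0) (g \in N).
Proof.
rewrite in_setI; have [gH|gH] := boolP (g \in H); last by constructor; case.
have gG := HG gH; apply: (iffP idP) => [/normP e | [_ e1]].
  split=> //; have : (w ^ g)%g \in ('C_H[w] :^ g)%g.
    by apply: imset_f; apply/setIP; split=> //; apply: cent1id.
  rewrite e => {e}.
  case/cent_wP=> _ + _; rewrite conjgE !entryM !entryV // w10 w0011.
  move=> e2; have /eqP : m01 w * (m10 g * m10 g) = 0 by rewrite -oppr0 -e2; ring.
  by rewrite !mulf_eq0 (negPf w01) orbb => /eqP.
rewrite inE; apply/subsetP=> _ /imsetP[h /cent_wP[hH h1 h2] ->].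
apply/cent_wP; split; first by rewrite groupJ.
  by rewrite conjgE !entryM !entryV // h1 h2 e1; ring.
by rewrite conjgE !entryM !entryV // h1 h2 e1; ring.
Qed.

Lemma cent_w : 'C_H[w]%g = (Z * P)%g.
Proof.
apply/setP=> g; apply/cent_wP/mulsgP => [[gH e1 e2] | [c u cZ /setIP[uH /upper_unipP[uG u1 u0 u2]] ->]].
  have dg := SLdet (HG gH); rewrite e1 mulr0 subr0 -e2 -expr2 in dg.
  have [c cZ [c0 c1 c2 c3]] := scalar_center dg.
  have cH := subsetP sZH c cZ.
  exists c (c^-1 * g)%g; rewrite ?mulKVg // in_setI groupM ?groupV //=.
  apply/upper_unipP; rewrite groupM ?groupV ?HG // !entryM !entryV ?HG //.
  by rewrite c0 c1 c2 c3 e1 -e2 -dg; split=> //; ring.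
have cH := subsetP sZH c cZ; have /centSLP[|c1 c2 c3] := cZ; first exact: HG.
by rewrite groupM // !entryM c1 c2 c3 u0 u1 u2; split=> //; ring.
Qed.

Lemma centI : (Z :&: P = 1)%g.
Proof.
apply/eqP; rewrite eqEsubset sub1set group1 andbT; apply/subsetP=> g.
case/setIP=> gZ /setIP[gH /upper_unipP[gG e1 e0 e2]]; apply/set1P.
by case/centSLP: gZ => // e3 _ _; apply: entryP; rewrite !entry1.
Qed.

Lemma ti_w : ti w = #|P|.
Proof.
have := card_cent sHG sZH wH; rewrite cent_w (TI_cardMg centI) => /eqP.
by rewrite eqn_pmul2l ?cardG_gt0 // => /eqP.
Qed.

Lemma T_sub_N : (T \subset N)%g.
Proof. by apply/subsetP=> g /setIP[gH /diagonalP[_ e _]]; apply/norm_wP. Qed.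

Lemma P_sub_N : (P \subset N)%g.
Proof. by apply/subsetP=> g /setIP[gH /upper_unipP[_ e _ _]]; apply/norm_wP. Qed.

Lemma det_upper g : g \in G -> m10 g = 0 -> m00 g * m11 g = 1.
Proof. by move/SLdet=> + e; rewrite e mulr0 subr0. Qed.

(** T is the centralizer of b in N, and the N-class of b is the coset b P: conjugation in N keeps
    the diagonal of b, and no nontrivial element of P commutes with b. Hence |N : T| = |P|. *)
Lemma card_N : #|N| = (#|P| * #|T|)%N.
Proof.
have cN : 'C_N[b]%g = T.
  rewrite -cent_b; apply/setP=> g; rewrite !in_setI.
  apply/andP/andP => [[/andP[gH _] gb] // | [gH gb]]; split=> //.
  by rewrite -in_setI (subsetP T_sub_N) // -cent_b in_setI gH.
have cP : 'C_P[b]%g = 1%g.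
  apply/eqP; rewrite eqEsubset sub1set group1 andbT; apply/subsetP=> g.
  case/setIP=> /setIP[gH /upper_unipP[gG e1 e0 e2]] gb; apply/set1P.
  have: g \in T by rewrite -cent_b in_setI gH.
  by case/setIP=> _ /diagonalP[_ _ e3]; apply: entryP; rewrite !entry1.
have sT : (T \subset N)%g := T_sub_N.
suff idx : #|N : T|%g = #|P| by rewrite -(Lagrange sT) idx mulnC.
rewrite -cN index_cent1.
apply/eqP; rewrite eqn_leq; apply/andP; split; last first.
  have -> : #|P| = #|P : 'C_P[b]|%g by rewrite cP indexg1.
  rewrite index_cent1; apply: subset_leq_card.
  by apply: imsetS; apply: P_sub_N.
rewrite -(card_lcoset P b); apply: subset_leq_card; apply/subsetP=> _ /imsetP[g /norm_wP[gH e1] ->].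
have gG := HG gH; have dg := det_upper gG e1; have db := det_upper b0 b10.
rewrite mem_lcoset in_setI groupM ?groupV ?groupJ //=.
apply/upper_unipP; rewrite !groupM ?groupV ?groupJ //.
rewrite conjgE !entryM !entryV // b01 b10 e1; split=> //; first ring.
- transitivity ((m00 g * m11 g) * (m00 b * m11 b)); first ring.
  by rewrite dg db mulr1.
- transitivity ((m00 g * m11 g) * (m00 b * m11 b)); first ring.
  by rewrite dg db mulr1.
Qed.

Lemma card_T : #|T| = (#|Z| * ti b)%N.
Proof. by rewrite -cent_b; apply: card_cent. Qed.

Lemma wi_w : wi w = ti b.
Proof.
have := Lagrange (cent_sub_norm H w); rewrite card_N card_T.
rewrite -/(wi w) (card_cent sHG sZH wH) ti_w => /eqP.
rewrite mulnCA -mulnA eqn_pmul2l ?cardG_gt0 // eqn_pmul2l ?cardG_gt0 //.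
by move/eqP.
Qed.

(** N fixes a line that y moves, and a unipotent of P fixing a second line is trivial, so
    [ti_conj_index] applies. *)
Lemma si_w_gt : (#|P| < si w)%N.
Proof.
have sNH : (N \subset H)%g by apply: subsetIl.
have yN : y \notin N by apply/negP => /norm_wP[_ e]; move: y10; rewrite e eqxx.
have tiP : ((N :^ y) :&: P = 1)%g.
  apply/eqP; rewrite eqEsubset sub1set group1 andbT; apply/subsetP=> g.
  case/setIP=> /imsetP[h /norm_wP[_ h1] eg] /setIP[gH /upper_unipP[gG e1 e0 e2]].
  have E : (h * y = y * g)%g by rewrite eg; apply: conjgC.
  have h2 : m11 h = 1.
    by apply: (mulIf y10); have := congr1 (@m10 F) E; rewrite !entryM h1 e1 e0;
      rewrite mul0r add0r mulr0 addr0 mulr1 mul1r.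
  have e3 : m01 g = 0.
    have := congr1 (@m11 F) E; rewrite !entryM h1 h2 e2 mul0r add0r mul1r mulr1 => E'.
    by apply: (mulfI y10); apply: (addIr (m11 y)); rewrite -E' mulr0 add0r.
  by apply/set1P; apply: entryP; rewrite !entry1.
exact: ti_conj_index sNH P_sub_N yH yN tiP.
Qed.

(** T acts by conjugation on the nontrivial elements of P, every stabilizer is Z, and so all orbits
    have |T : Z| elements. *)
Lemma ti_b_dvd : (ti b %| #|P|.-1)%N.
Proof.
have bN g : g \in T -> g \in 'N(P)%g.
  move=> /setIP[gH /diagonalP[gG e1 e2]]; rewrite inE; apply/subsetP=> _ /imsetP[u /setIP[uH /upper_unipP[uG u1 u0 u2]] ->].
  rewrite in_setI groupJ //=; apply/upper_unipP; have dg := det_upper gG e1.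
  rewrite groupJ // conjgE !entryM !entryV // e1 e2 u1 u0 u2.
  by split=> //; first [ring | rewrite -[RHS]dg; ring].
have acts : [acts T, on P^# | 'J]%g.
  apply/actsP=> g gT u; rewrite !in_setD1 /= conjg_eq1 memJ_norm //; exact: bN.
have cP1 : #|P^#%g| = #|P|.-1 by rewrite (cardsD1 1%g P) group1.
rewrite -cP1 -(acts_sum_card_orbit acts); apply: dvdn_sum => _ /imsetP[u uP ->].
have /setD1P[u1 /setIP[uH /upper_unipP[uG v1 v0 v2]]] := uP.
have uZ : u \notin Z.
  apply: contra u1 => /centSLP[] // e1 _ _; apply/eqP; apply: entryP; rewrite ?entry1 //.
have u01 : m01 u != 0.
  by apply: contra u1 => /eqP e; apply/eqP; apply: entryP; rewrite ?entry1.
have -> : orbit 'J%act T u = (u ^: T)%g by [].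
rewrite -index_cent1; have -> : 'C_T[u]%g = Z.
  apply/setP=> g; rewrite [g \in 'C_T[u]%g]in_setI [g \in T]in_setI; apply/andP/idP => [[/andP[gH /diagonalP[gG e1 e2]] /comm_entry[_ e3 _]]|gZ].
    apply/centSLP => //; split=> //; apply/eqP; rewrite -subr_eq0.
    by move: e3; rewrite v0 v2 e2 subrr !mulr0 => /esym/eqP; rewrite mulf_eq0 (negPf u01).
  rewrite (subsetP sZH) // center_diag //; split=> //.
  have := subsetP (center_sub_cent sHG sZH uH) g gZ; by rewrite in_setI => /andP[].
apply/dvdnP; exists 1%N; rewrite mul1n; apply/eqP; rewrite /torus_index cent_b //.
Qed.

Lemma cs_parabolic_upper g : g \in H -> g \notin Z -> m10 g = 0 -> mtr g ^+ 2 = 4 -> g \in cs w.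
Proof.
move=> gH gZ g10 tg; have := tr_parabolic (HG gH); rewrite tg subrr g10 !mulr0 addr0.
move=> /esym/eqP; rewrite sqrf_eq0 subr_eq0 => /eqP e.
have gw : g \in 'C_H[w]%g by apply/cent_wP.
apply: (subsetP (sub_class_support _ _)); by rewrite in_setD gZ.
Qed.

(** With both off-diagonal entries of g nonzero, c has opposite diagonal entries and the
    characteristic is odd. Conjugation by c then negates the off-diagonal entries of g, so commuting
    forces equal diagonal entries, against trace^2 = 4. *)
Lemma diag_normal_parabolic g c : c \in G -> m10 c = 0 -> m01 c = 0 -> m00 c != m11 c ->
  g \in G -> mtr g ^+ 2 = 4 -> (g ^ c)%g \in 'C[g]%g -> m10 g = 0 \/ m01 g = 0.
Proof.
move=> cG c10 c01 c0011 gG tg; have dc := det_upper cG c10.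
move=> /comm_entry[]; rewrite conjgE !entryM !entryV // c10 c01 => e1 e2 e3.
apply/pred2P; rewrite -[_ || _]/((_ == 0) || (_ == 0)); apply/negPn/negP; rewrite negb_or => /andP[n1 n2].
have n3 : m00 c - m11 c != 0 by rewrite subr_eq0.
have lm : m00 c + m11 c = 0.
  move/eqP: e1; rewrite -subr_eq0 => /eqP e1.
  have /eqP : m01 g * (m10 g * ((m00 c - m11 c) * (m00 c + m11 c))) = 0.
    by rewrite -[RHS]oppr0 -[in RHS]e1; ring.
  by rewrite !mulf_eq0 (negPf n1) (negPf n2) (negPf n3) => /eqP.
have em : m11 c = - m00 c by apply/eqP; rewrite -addr_eq0 addrC lm.
have n4 : (2 : F) != 0.
  by apply: contra n3 => /eqP z; rewrite em opprK -mulr2n -mulr_natr z mulr0.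
have [/eqP ps|ps] := boolP (m00 g - m11 g == 0).
  have := tr_parabolic gG; rewrite tg subrr ps expr0n add0r => /esym/eqP.
  rewrite !mulf_eq0 (negPf n1) (negPf n2) !orbF -[4%N]/(2 * 2)%N natrM mulf_eq0.
  by rewrite (negPf n4).
have /eqP : m01 g * (m00 g - m11 g) * (m11 c ^+ 2 - m00 c * m11 c) = 0.
  move/eqP: e2; rewrite -subr_eq0 => /eqP e2.
  by rewrite -[RHS]e2; ring.
rewrite dc !mulf_eq0 (negPf n2) (negPf ps) /= subr_eq0 => /eqP em2.
have : (2 : F) = 0 by transitivity (m11 c ^+ 2 + m00 c * m11 c); [by rewrite em2 dc | by rewrite em; ring].
by move/eqP; rewrite (negPf n4).
Qed.

(** Weyl index 2 gives an element normalizing T outside T; it must exchange the two coordinate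
    axes. *)
Lemma weyl_swap : exists2 n : GL2 F, n \in H & m00 n = 0 /\ m11 n = 0.
Proof.
have [n nN nT] : exists2 n : GL2 F, n \in 'N_H('C_H[b])%g & n \notin 'C_H[b]%g.
  apply/subsetPn.
  have : ~~ ('N_H('C_H[b]) \subset 'C_H[b])%g.
    rewrite -indexg_eq1 -/(wi b).
    by rewrite (weyl_index_split sHG sZH bH yH tb sb nsy ab ay).
  by [].
have [nH nC] := setIP nN; have nG := HG nH; exists n => //.
have : (b ^ n)%g \in T by rewrite -cent_b; apply: norm_cent1J bH nN.
case/setIP=> _ /diagonalP[_]; rewrite conjgE !entryM !entryV // b10 b01 => e1 e2.
have /eqP : (m00 b - m11 b) * (m00 n * m10 n) = 0 by rewrite -[RHS]oppr0 -[in RHS]e1; ring.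
rewrite mulf_eq0 (negPf sub0) mulf_eq0 /= => z1.
have /eqP : (m00 b - m11 b) * (m01 n * m11 n) = 0 by rewrite -[RHS]e2; ring.
rewrite mulf_eq0 (negPf sub0) mulf_eq0 /= => z2.
have dn := SLdet nG.
have [r0|r0] := eqVneq (m10 n) 0; last first.
  move: z1; rewrite (negPf r0) orbF => /eqP z1; split=> //.
  move: dn z2; rewrite z1 mul0r; case: eqVneq => [->|_ _ /eqP //].
  by rewrite mul0r subr0 => /esym/eqP; rewrite oner_eq0.
case/negP: nT; rewrite cent_b in_setI nH /=; apply/diagonalP; split=> //.
move: z2 dn => /orP[/eqP //|/eqP ->]; rewrite r0 !mulr0 subrr => /esym/eqP.
by rewrite oner_eq0.
Qed.

(* Once g is normalized by a noncentral diagonal matrix it is upper or lower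
   triangular, and weyl_swap exchanges the two cases. *)
Lemma parabolic_cs g : g \in H -> g \notin Z -> mtr g ^+ 2 = 4 -> g \in cs w.
Proof.
move=> gH gZ tg; have gG := HG gH.
have [c cN cC] := parabolic_normalizer sHG sZH bH yH tb sb nsy ab ay gH gZ tg.
have [cH cn] := setIP cN; have cG := HG cH.
have gc : (g ^ c)%g \in 'C[g]%g.
  by case/setIP: (norm_cent1J gH cN).
have [tc sc] := normalizer_split gG gZ tg cG gc cC.
(* c is split and the block of y has no split elements, so c is H-conjugate into T. *)
have cb : c \in cs b.
  have /setUP[//|cy] := semisimple_cover sHG sZH bH yH tb sb nsy ab ay cH tc.
  by move: nsy; rewrite -(cs_type sHG yH yZ cy) sc.
have [_ _ [l lH el]] := cent_suppP (@SL_comm_tr F) sHG bH bZ cb.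
have [k kH cT] : exists2 k : GL2 F, k \in H & (c ^ k)%g \in T.
  exists l^-1%g; first exact: groupVr lH.
  by rewrite -cent_b -mem_conjg -el in_setI cH cent1id.
have kG := HG kH; case/setIP: cT => c1H /diagonalP[c1G c10 c01].
have c0011 : m00 (c ^ k)%g != m11 (c ^ k)%g.
  move: tc; rewrite -(mtrJ c kG) -subr_eq0 (tr_parabolic c1G) c10 !mulr0 addr0.
  by rewrite sqrf_eq0 subr_eq0.
have g1H : (g ^ k)%g \in H := groupJ gH kH.
have g1Z : (g ^ k)%g \notin Z by rewrite (notin_centerJ sHG _ kH).
have tg1 : mtr (g ^ k)%g ^+ 2 = 4 by rewrite (mtrJ _ kG).
have gc1 : ((g ^ k) ^ (c ^ k))%g \in 'C[g ^ k]%g by rewrite -conjJg mem_cent1J.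
apply: (cent_supp_conj kH).
have [e|e] := diag_normal_parabolic c1G c10 c01 c0011 (HG g1H) tg1 gc1.
  exact: cs_parabolic_upper.
have [n nH [n0 n1]] := weyl_swap; apply: (cent_supp_conj nH).
move: g1H g1Z tg1 e; move: (g ^ k)%g => u uH uZ tu u01.
apply: cs_parabolic_upper.
- exact: groupJ uH nH.
- by rewrite (notin_centerJ sHG _ nH).
- by rewrite conjgE !entryM !(entryV (HG nH)) u01 n0; ring.
- by rewrite (mtrJ _ (HG nH)).
Qed.

(** All parabolic elements form the single block of w; the other noncentral ones lie in the blocks
    of b and y. *)
Lemma full_cover : (#|H : Z|.-1 =
  (ti b).-1 * si b + (ti y).-1 * si y + #|P|.-1 * si w)%N.
Proof.
have yb : y \notin cs b by apply: contra nsy => /(cs_type sHG bH bZ) ->; exact: sb.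
have ty : mtr y ^+ 2 != 4 by apply: contra nsy => /eqP; apply: parabolic_eig.
have tw : mtr w ^+ 2 = 4.
  by apply/eqP; rewrite -subr_eq0 tr_parabolic ?HG // w0011 subrr w10 !mulr0 expr0n addr0.
have wb : w \notin cs b by apply: contra tb => /(cs_type sHG bH bZ)[<- _]; rewrite tw.
have wy : w \notin cs y by apply: contra ty => /(cs_type sHG yH yZ)[<- _]; rewrite tw.
have ct := @SL_comm_tr F.
have d1 := cent_supp_disjoint ct sHG bH bZ yH yZ yb.
have d2 := cent_supp_disjoint ct sHG bH bZ wH wZ wb.
have d3 := cent_supp_disjoint ct sHG yH yZ wH wZ wy.
have cov : (H :\: Z = cs b :|: cs y :|: cs w)%g.
  apply/eqP; rewrite eqEsubset !subUset !(cent_supp_sub ct sHG) // !andbT.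
  apply/subsetP=> g /setDP[gH gZ]; rewrite in_setU.
  have [/eqP tg|tg] := boolP (mtr g ^+ 2 == 4); first by rewrite parabolic_cs ?orbT.
  by rewrite (semisimple_cover sHG sZH bH yH tb sb nsy ab ay gH tg).
have := congr1 (fun A : {set GL2 F} => #|A|) cov; rewrite card_noncentral //.
rewrite cardsU setIUl (disjoint_setI0 d2) (disjoint_setI0 d3) setU0 cards0 subn0.
rewrite cardsU (disjoint_setI0 d1) cards0 subn0.
rewrite !(card_cent_supp_index sHG sZH ct) // ti_w -!mulnDr => /eqP.
by rewrite eqn_pmul2l ?cardG_gt0 // => /eqP.
Qed.

Lemma card_P_gt1 : (1 < #|P|)%N.
Proof. by rewrite -ti_w; apply: torus_index_gt1 wZ. Qed.

Lemma torus_orders : exists2 s, (s <= 2)%N & (s * ti b = #|P|.-1)%N /\ (s * ti y = #|P|.+1)%N.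
Proof.
have /dvdnP[s es] := ti_b_dvd.
have e1 := index_factor sHG sZH bH; have e2 := index_factor sHG sZH yH.
have e3 := index_factor sHG sZH wH.
rewrite (weyl_index_split sHG sZH bH yH tb sb nsy ab ay) in e1.
rewrite (weyl_index_nonsplit sHG sZH bH yH tb sb nsy ab ay) in e2.
rewrite wi_w ti_w in e3.
have [s2 ey] := class_equation ab ay card_P_gt1 si_w_gt e1 e2 e3 full_cover es.
by exists s.
Qed.

Lemma unip_dvd : (#|P| %| #|F|)%N.
Proof. by rewrite -card_upper_unip; apply: cardSg; apply: subsetIr. Qed.

Lemma ti_dvd_split : (ti b %| #|F|.-1)%N.
Proof.
rewrite -card_diagonal; apply: dvdn_trans (cardSg (subsetIr H (diagonal F))).
by rewrite card_T dvdn_mull.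
Qed.

(** If P is not the full unipotent group, q = r Q with r > 1. The torus order of b divides Q - 1 and
    q - 1, hence r - 1; as Q - 1 is at most twice that order, Q < 2 r and Q^2 < 2 q. *)
Lemma core_dichotomy : H :=: G \/ exists Q,
  [/\ 1 < Q, Q %| #|F|, Q ^ 2 < 2 * #|F|, ti b %| Q.-1 & ti y %| Q.+1]%N.
Proof.
have [s s2 [eb ey]] := torus_orders.
have [eP|nP] := eqVneq #|P| #|F|.
  left; apply: (upper_unip_generate sHG _ yH y10).
  have /eqP <- : P == upper_unip F; last exact: subsetIl.
  by rewrite eqEcard subsetIr card_upper_unip eP leqnn.
right; exists #|P|; have /dvdnP[r er] := unip_dvd; have df := ti_dvd_split.
have P0 : (0 < #|P|)%N := cardG_gt0 _.
have db : (ti b %| #|P|.-1)%N by rewrite -eb dvdn_mull.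
split=> //; [exact: card_P_gt1 | exact: unip_dvd | | by rewrite -ey dvdn_mull].
have r1 : (1 < r)%N.
  case: r er => [|[|r]] // er; last by rewrite er mul1n eqxx in nP.
  by have := finNzRing_gt1 F; rewrite er.
have dr : (ti b %| r.-1)%N.
  have e : (#|F|.-1 = r * #|P|.-1 + r.-1)%N.
    rewrite er -[in LHS](prednK P0) mulnS; case: (r) r1 => // k _.
    by rewrite addSn /= addnC.
  by move: df; rewrite e dvdn_addr // dvdn_mull.
have le : (ti b <= r.-1)%N by apply: dvdn_leq dr; case: (r) r1 => [|[]].
have : (#|P|.-1 <= 2 * r.-1)%N by rewrite -eb leq_mul.
move: P0 r1; rewrite er; move: #|P| => Q; clear => Q0 r1 le.
rewrite expnS expn1 mulnA ltn_pmul2r //; lia.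
Qed.

End Core.

Section Dichotomy.
Variables (F : finFieldType).
Local Open Scope ring_scope.
Implicit Types (g h k x y : GL2 F) (H : {group GL2 F}).
Local Notation G := (SL2 F).
Local Notation Z := ('Z(G)%g).

Lemma centerJ M : M \in G -> Z :^ M = Z.
Proof.
move=> MG; apply/normP; apply: (subsetP (normal_norm (center_normal G))) MG.
Qed.

Lemma torus_indexJ H g M : H \subset G -> Z \subset H -> g \in H -> M \in G ->
  torus_index G (H :^ M)%G (g ^ M)%g = torus_index G H g.
Proof.
move=> sHG sZH gH MG; have sH1 : (H :^ M)%G \subset G by rewrite /= -(conjGid MG) conjSg.
have sZ1 : Z \subset (H :^ M)%G by rewrite /= -(centerJ MG) conjSg.
have g1 : (g ^ M)%g \in (H :^ M)%G by rewrite /= memJ_conjg.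
have := card_cent sH1 sZ1 g1.
have -> : #|'C_(H :^ M)[g ^ M]| = #|'C_H[g]|.
  by rewrite /= -(cardJg 'C_H[g] M) conjIg -normJ conjg_set1.
rewrite (card_cent sHG sZH gH) => /eqP.
by rewrite eqn_pmul2l ?cardG_gt0 // => /eqP.
Qed.

(** 12 is the least common multiple of 2, 4 and 6: if g^t is central with t <= 3, then g^(2t) =
    1. *)
Lemma torus_index_ge4 H g : H \subset G -> Z \subset H -> g \in H ->
  (g ^+ 12)%g != 1%g -> (4 <= torus_index G H g)%N.
Proof.
move=> sHG sZH gH; apply: contraR; rewrite -ltnNge => lt.
have /centerX2 := expg_torus_index sHG gH; rewrite -expgM => e.
have : (0 < torus_index G H g)%N by apply: indexg_gt0.
case: torus_index lt e => [|[|[|[|]]]] // _ e _.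
- by rewrite -[12%N]/(2 * 6)%N expgM e expg1n.
- by rewrite -[12%N]/(4 * 3)%N expgM e expg1n.
- by rewrite -[12%N]/(6 * 2)%N expgM e expg1n.
Qed.

Lemma expg_dvd_torus H g n : H \subset G -> Z \subset H -> g \in H ->
  (torus_index G H g %| n)%N -> (g ^+ (2 * n) = 1)%g.
Proof.
move=> sHG sZH gH /dvdnP[m ->]; have /centerX2 := expg_torus_index sHG gH.
by rewrite -expgM => e; rewrite mulnC -mulnA mulnC expgM e expg1n.
Qed.

(** Coordinates are adapted to a parabolic w and some b normalizing its centralizer, not to x. Being
    split, b lies in the block of x and has the same torus index, so the conclusion transfers. *)
Theorem SL2_dichotomy H x y : H \subset G -> Z \subset H -> x \in H -> y \in H ->
  mtr x ^+ 2 != 4 -> has_eig (mtr x) -> ~~ has_eig (mtr y) ->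
  (x ^+ 12)%g != 1%g -> (y ^+ 12)%g != 1%g ->
  H :=: G \/ exists Q, [/\ (1 < Q)%N, (Q %| #|F|)%N, (Q ^ 2 < 2 * #|F|)%N,
     (x ^+ (2 * Q.-1) = 1)%g & (y ^+ (2 * Q.+1) = 1)%g].
Proof.
move=> sHG sZH xH yH tx sx nsy x12 y12.
have ax := torus_index_ge4 sHG sZH xH x12; have ay := torus_index_ge4 sHG sZH yH y12.
have HG g : g \in H -> g \in G by apply: (subsetP sHG).
have xZ : x \notin Z by apply: parabolicZ => //; apply: HG.
have [w [wH wZ tw]] := parabolic_exists sHG sZH xH yH tx sx nsy ax ay.
have [b bN bC] := parabolic_normalizer sHG sZH xH yH tx sx nsy ax ay wH wZ tw.
have bH : b \in H by case/setIP: bN.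
have wb : (w ^ b)%g \in 'C[w]%g by case/setIP: (norm_cent1J wH bN).
have [tb sb] := normalizer_split (HG _ wH) wZ tw (HG _ bH) wb bC.
have yZ : y \notin Z by apply: parabolicZ (HG _ yH) _; apply: contra nsy => /eqP; apply: parabolic_eig.
have bx : b \in cent_supp G H x.
  have /setUP[//|cy] := semisimple_cover sHG sZH xH yH tx sx nsy ax ay bH tb.
  by move: nsy; rewrite -(cs_type sHG yH yZ cy) sb.
have ebx := torus_index_eq sHG sZH (@SL_comm_tr F) xH xZ bx.
have [M MG [[w10 w0011 w01] [b10 b01 b0011]]] := borel_coords (HG _ wH) wZ tw (HG _ bH) wb bC.
have sH1 : (H :^ M)%G \subset G by rewrite /= -(conjGid MG) conjSg.
have sZ1 : Z \subset (H :^ M)%G by rewrite /= -(centerJ MG) conjSg.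
have mJ g : g \in H -> (g ^ M)%g \in (H :^ M)%G by rewrite /= memJ_conjg.
have nsy1 : ~~ has_eig (mtr (y ^ M)%g) by rewrite mtrJ.
have ab1 : (4 <= torus_index G (H :^ M)%G (b ^ M)%g)%N by rewrite torus_indexJ // ebx.
have ay1 : (4 <= torus_index G (H :^ M)%G (y ^ M)%g)%N by rewrite torus_indexJ.
have := core_dichotomy sH1 sZ1 (mJ _ wH) w10 w0011 w01 (mJ _ bH) b10 b01 b0011 (mJ _ yH) nsy1 ab1 ay1.
rewrite !torus_indexJ // ebx => -[/= e|[Q [Q1 dQ lQ dx dy]]].
  by left; apply: (can_inj (conjsgK M)); rewrite e conjGid.
by right; exists Q; split=> //; apply: (expg_dvd_torus sHG sZH).
Qed.
End Dichotomy.

(** * Traces of elements of bounded order *)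

Section Traces.
Variables (F : finFieldType).
Local Open Scope ring_scope.
Implicit Types (g h k : GL2 F) (t : F).
Local Notation G := (SL2 F).
Local Notation Z := ('Z(G)%g).

(* Chebyshev polynomials: g ^ n.+1 = cheb n.+1 (tr g) * g - cheb n (tr g) in SL_2. *)
Fixpoint cheb n : {poly F} :=
  if n is n1.+1 then (if n1 is n2.+1 then cheb n1 * 'X - cheb n2 else 1) else 0.

Arguments cheb : simpl never.

Lemma chebSS n : cheb n.+2 = cheb n.+1 * 'X - cheb n. Proof. by []. Qed.

Lemma size_cheb n : size (cheb n) = n.
Proof.
suff: size (cheb n) = n /\ size (cheb n.+1) = n.+1 by case.
elim: n => [|n [IH0 IH1]]; first by rewrite size_poly0 size_poly1.
split=> //; rewrite chebSS.
have nz : cheb n.+1 != 0 by rewrite -size_poly_eq0 IH1.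
by rewrite size_polyDl size_mulX // IH1 // size_polyN IH0.
Qed.

Definition pow_traces n : {set F} := [set t | root (cheb n) t].

Lemma card_pow_traces n : (0 < n)%N -> (#|pow_traces n| < n)%N.
Proof.
move=> n0; rewrite cardE -[X in (_ < X)%N]size_cheb; apply: max_poly_roots.
- by rewrite -size_poly_eq0 size_cheb -lt0n.
- by apply/allP=> t; rewrite mem_enum inE.
- exact: enum_uniq.
Qed.

Lemma entryX g n : g \in G ->
  (m00 (g ^+ n.+1)%g = (cheb n.+1).[mtr g] * m00 g - (cheb n).[mtr g]) *
  (m01 (g ^+ n.+1)%g = (cheb n.+1).[mtr g] * m01 g) *
  (m10 (g ^+ n.+1)%g = (cheb n.+1).[mtr g] * m10 g) *
  (m11 (g ^+ n.+1)%g = (cheb n.+1).[mtr g] * m11 g - (cheb n).[mtr g]).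
Proof.
move=> gG; have dg := SLdet gG; elim: n => [|n [[[IH0 IH1] IH2] IH3]].
  by rewrite expg1 /= hornerC horner0 !mul1r !subr0.
rewrite expgS !entryM IH0 IH1 IH2 IH3 chebSS hornerD hornerN hornerM hornerX.
move: (_.[_]) (_.[_]) => b a; rewrite /mtr; split; [split; [split|]|].
- transitivity (a * (m00 g * (m00 g + m11 g) - (m00 g * m11 g - m01 g * m10 g)) - b * m00 g).
    by ring.
  by rewrite dg; ring.
- by ring.
- by ring.
- transitivity (a * (m11 g * (m00 g + m11 g) - (m00 g * m11 g - m01 g * m10 g)) - b * m11 g).
    by ring.
  by rewrite dg; ring.
Qed.

(** For noncentral g the matrices 1 and g are independent, so the coefficient of g in g^n must
    vanish. *)
Lemma mem_pow_traces g n : g \in G -> g \notin Z -> (0 < n)%N -> (g ^+ n = 1)%g ->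
  mtr g \in pow_traces n.
Proof.
case: n => // n gG gZ _ e; rewrite inE /root.
have [[[e0 e1] e2] e3] := entryX n gG; rewrite e !entry1 in e0 e1 e2 e3.
case: (noncentral_entry gG gZ) => nz.
- by move/esym/eqP: e1; rewrite mulf_eq0 (negPf nz) orbF.
- by move/esym/eqP: e2; rewrite mulf_eq0 (negPf nz) orbF.
- have /eqP : (cheb n.+1).[mtr g] * (m00 g - m11 g) = 0.
    transitivity (((cheb n.+1).[mtr g] * m00 g - (cheb n).[mtr g])
      - ((cheb n.+1).[mtr g] * m11 g - (cheb n).[mtr g])); first by ring.
    by rewrite -e0 -e3 subrr.
  by rewrite mulf_eq0 (negPf nz) orbF.
Qed.

Lemma geometric_bound (x N n : nat) : (1 < x)%N ->
  (\sum_(i < n | x ^ i < N) x ^ i <= 2 * N)%N.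
Proof.
move=> x1.
have le m : (\sum_(i < m | x ^ i < N) x ^ i <= x ^ m)%N.
  elim: m => [|m IH]; first by rewrite big_ord0.
  rewrite big_mkcond big_ord_recr -big_mkcond /= expnS.
  apply: (@leq_trans (x ^ m + x ^ m)); last by rewrite addnn -mul2n leq_mul2r x1 orbT.
  by apply: leq_add => //; case: ifP.
elim: n => [|n IH]; first by rewrite big_ord0.
rewrite big_mkcond big_ord_recr -big_mkcond /=; case: ifP => [lt|_]; last by rewrite addn0.
by rewrite mul2n -addnn; apply: leq_add; [apply: leq_trans (le n) _ | ]; apply: ltnW.
Qed.

(* Off pow_traces 12, an element has order at least 4 modulo the center; Q runs over
   the orders of possible proper subfields. *)
Definition bad_traces : {set F * F} := [set t |
  [|| t.1 \in pow_traces 12, t.2 \in pow_traces 12 |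
    [exists Q : 'I_(2 * #|F|), [&& 1 < Q, Q %| #|F|, Q ^ 2 < 2 * #|F|,
      t.1 \in pow_traces (2 * Q.-1) & t.2 \in pow_traces (2 * Q.+1)]%N]]].

Lemma bad_tracesE t1 t2 : ((t1, t2) \in bad_traces) =
  [|| t1 \in pow_traces 12, t2 \in pow_traces 12 |
    [exists Q : 'I_(2 * #|F|), [&& 1 < Q, Q %| #|F|, Q ^ 2 < 2 * #|F|,
      t1 \in pow_traces (2 * Q.-1) & t2 \in pow_traces (2 * Q.+1)]%N]].
Proof. by rewrite [LHS]in_set. Qed.

Lemma finField_card_prime_power : exists p n, prime p /\ #|F| = (p ^ n)%N.
Proof.
have /is_abelemP[p pp ab] := finField_is_abelem F; exists p, (logn p #|F|); split=> //.
by have := card_pgroup (abelem_pgroup ab); rewrite cardsT.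
Qed.

(** Each condition at 12 costs at most 11 q pairs. Each Q costs at most (2 Q - 3)(2 Q + 1) <= 4 Q^2,
    and the Q^2 below 2 q sum to at most 4 q. The total is 38 q. *)
Lemma card_bad_traces : (#|bad_traces| <= 40 * #|F|)%N.
Proof.
have [p [n [pp eq]]] := finField_card_prime_power.
have p1 := prime_gt1 pp.
pose A m := setX (pow_traces (2 * (p ^ m).-1)) (pow_traces (2 * (p ^ m).+1)).
pose I (m : 'I_n.+1) := (0 < m)%N && ((p ^ 2) ^ m < 2 * #|F|)%N.
have sub : bad_traces \subset (setX (pow_traces 12) setT :|: setX setT (pow_traces 12))
     :|: \bigcup_(m in I) A m.
  apply/subsetP=> -[t1 t2]; rewrite bad_tracesE 2!in_setU 2!in_setX !in_setT /= andbT.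
  case/or3P=> [->|->|]; rewrite ?orbT //.
  case/existsP=> Q /and5P[Q1 dQ lt h1 h2].
  have [m le eQ] : exists2 m, (m <= n)%N & (Q = p ^ m :> nat)%N.
    by apply/dvdn_pfactor=> //; rewrite -eq.
  apply/orP; right; apply/bigcupP; exists (Ordinal (le : m < n.+1)%N).
    rewrite unfold_in /I /= -expnM mulnC expnM -eQ lt andbT lt0n.
    by apply: contraTneq Q1 => m0; rewrite eQ m0.
  by rewrite in_setX /= -eQ h1.
have cA m : (0 < m)%N -> (#|A m| <= 4 * (p ^ 2) ^ m)%N.
  move=> m0; have Q1 : (1 < p ^ m)%N by rewrite -{1}(exp1n m) ltn_exp2r.
  rewrite cardsX -expnM [(2 * m)%N]mulnC expnM.
  have l1 : (#|pow_traces (2 * (p ^ m).-1)| <= 2 * (p ^ m - 1) - 1)%N.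
    by rewrite -ltnS subn1 -subn1 prednK ?card_pow_traces // muln_gt0 /= ?subn1 -ltnS prednK // ltnW.
  have l2 : (#|pow_traces (2 * (p ^ m).+1)| <= 2 * (p ^ m + 1) - 1)%N.
    by rewrite -ltnS addn1 subn1 prednK ?card_pow_traces.
  apply: leq_trans (leq_mul l1 l2) _; move: Q1; move: (p ^ m)%N; clear.
  by case=> [|[|Q]] // _; rewrite expnS expn1; lia.
have := subset_leq_card sub.
have cU : (#|\bigcup_(m in I) A m| <= \sum_(m in I) #|A m|)%N.
  elim/big_rec2: _ => [|m k B _ IH]; first by rewrite cards0.
  by apply: leq_trans (leq_card_setU _ _) _; rewrite leq_add2l.
have sU : (\sum_(m in I) #|A m| <= 16 * #|F|)%N.
  have p21 : (1 < p ^ 2)%N by rewrite -{1}(exp1n 2) ltn_exp2r.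
  have := geometric_bound (2 * #|F|) n.+1 p21.
  rewrite -(leq_pmul2l (isT : 0 < 4)%N) big_distrr /= !mulnA; apply: leq_trans.
  rewrite big_mkcond [leqRHS]big_mkcond; apply: leq_sum => m _.
  rewrite unfold_in /I; case: (posnP m) => [_|m0] //=; case: ifP => // _; exact: cA.
have cB : (#|pow_traces 12| <= 11)%N by rewrite -ltnS card_pow_traces.
move/leq_trans; apply; apply: leq_trans (leq_card_setU _ _) _.
apply: (@leq_trans ((11 * #|F| + 11 * #|F|) + 16 * #|F|)); last by rewrite -!mulnDl leq_mul2r orbT.
apply: leq_add; last exact: leq_trans cU sU.
apply: leq_trans (leq_card_setU _ _) _; rewrite !cardsX cardsT.
by apply: leq_add; [ | rewrite mulnC]; rewrite leq_mul2r cB orbT.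
Qed.
End Traces.

(** * Conjugacy classes of PSL_2 *)

Section Classes.
Variables (F : finFieldType).
Local Open Scope ring_scope.
Implicit Types (g h k : GL2 F) (t : F).
Local Notation G := (SL2 F).
Local Notation Z := ('Z(G)%g).
Local Notation S := (G / Z)%G.

Definition coset_class g := (coset Z g ^: S)%g.
(** [comp t 1] is only a representative: for t^2 != 4 every element of trace t yields this class. *)
Definition trace_class t := coset_class (comp t 1).

Lemma SL2_normZ g : g \in G -> g \in 'N(Z)%g.
Proof. exact: (subsetP (normal_norm (center_normal _))). Qed.

Lemma coset_class_in g : g \in G -> coset_class g \in classes S.
Proof. by move=> gG; apply: mem_classes; apply: mem_quotient. Qed.

Lemma coset_classP C : C \in classes S -> exists2 g, g \in G & C = coset_class g.
Proof. by case/imsetP=> _ /morphimP[g _ gG ->] ->; exists g. Qed.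

Lemma mem_coset_class g x : g \in G -> x \in coset_class g ->
  exists2 h, h \in G & x = coset Z (g ^ h)%g.
Proof.
move=> gG /imsetP[_ /morphimP[h hN hG ->] ->]; exists h => //.
by rewrite morphJ // SL2_normZ.
Qed.

Lemma coset_classJ g h : g \in G -> h \in G -> coset_class (g ^ h)%g = coset_class g.
Proof.
move=> gG hG; rewrite /coset_class morphJ ?SL2_normZ //.
by rewrite classGidl // mem_quotient.
Qed.

Lemma coset_class_central c g : c \in Z -> coset_class (c * g)%g = coset_class g.
Proof. by move=> cZ; rewrite /coset_class coset_kerl. Qed.

Lemma coset_class_trace g : g \in G -> mtr g ^+ 2 != 4 -> coset_class g = trace_class (mtr g).
Proof.
move=> gG tg; have [M MG eM] := SL_conj_comp gG tg.
by rewrite /trace_class -eM coset_classJ.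
Qed.

Lemma neg1_center : exists2 c, c \in Z & forall g, mtr (c * g)%g = - mtr g.
Proof.
have [|c cZ [c0 c1 c2 c3]] := @scalar_center F (-1); first by rewrite sqrrN expr1n.
by exists c => // g; rewrite /mtr !entryM c0 c1 c2 c3; ring.
Qed.

Lemma coset_class_eq_trace g h : g \in G -> h \in G -> coset_class g = coset_class h ->
  mtr h = mtr g \/ mtr h = - mtr g.
Proof.
move=> gG hG e; have : coset Z h \in coset_class g by rewrite e class_refl.
case/(mem_coset_class gG) => k kG ehg; rewrite -(mtrJ g kG).
have gkG : (g ^ k)%g \in G by rewrite groupJ.
move: (g ^ k)%g gkG ehg => u uG ehu.
have [c cZ ->] := kercoset_rcoset (SL2_normZ hG) (SL2_normZ uG) ehu.
have cG : c \in G := subsetP (center_sub _) c cZ.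
case/centSLP: (cZ) => // c1 c2 c3; have := SLdet cG; rewrite c1 mul0r subr0 -c3 -expr2.
rewrite /mtr !entryM c1 c2 -c3 => /eqP; rewrite sqrf_eq1 => /orP[] /eqP ->; [left|right]; ring.
Qed.

Lemma trace_class_neg t : t ^+ 2 != 4 -> trace_class (- t) = trace_class t.
Proof.
move=> t4; have [c cZ ec] := neg1_center; have o := oner_neq0 F.
rewrite [in RHS]/trace_class -(coset_class_central (comp t 1) cZ).
have cG : c \in G := subsetP (center_sub _) c cZ.
rewrite coset_class_trace ?ec ?mtr_comp ?groupM ?compG ?sqrrN //.
Qed.

Lemma has_eigN t : has_eig (- t) = has_eig t.
Proof.
have imp s : has_eig s -> has_eig (- s).
  by case/has_eigP=> l el; apply/has_eigP; exists (- l); rewrite -el; ring.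
by apply/idP/idP => /imp; rewrite ?opprK.
Qed.

Definition split_traces : {set F} := [set t | (t ^+ 2 != 4) && has_eig t].
Definition nonsplit_traces : {set F} := [set t | ~~ has_eig t].
Definition split_classes := [set trace_class t | t in split_traces].
Definition nonsplit_classes := [set trace_class t | t in nonsplit_traces].

Lemma nonsplit_sqr t : ~~ has_eig t -> t ^+ 2 != 4.
Proof. by apply: contra => /eqP; apply: parabolic_eig. Qed.

(** The two products of the elementary matrices agree off the diagonal but have 1 and 2 in a corner,
    so no scalar relates them. *)
Lemma PSL2_nonabelian : ~~ abelian S.
Proof.
have e1 : 1 * 1 - 1 * 0 = 1 :> F by ring.
have e2 : 1 * 1 - 0 * 1 = 1 :> F by ring.
have [uG lG] := (gl2_SL e1, gl2_SL e2).
apply/negP => /centsP ab; have := ab _ (mem_quotient Z uG) _ (mem_quotient Z lG).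
rewrite /commute -!morphM ?SL2_normZ // => e.
have [||c cZ] := kercoset_rcoset _ _ e; try by rewrite SL2_normZ // groupM.
have cG : c \in G := subsetP (center_sub _) c cZ.
case/centSLP: cZ => // c1 c2 c3 E.
have := congr1 (@m01 F) E; have := congr1 (@m00 F) E.
rewrite !entryM !gl2E // c1 !(mul0r, mulr0, mul1r, mulr1, addr0, add0r) => <- /eqP.
by rewrite -{1}[1]addr0 (inj_eq (addrI 1)) eq_sym oner_eq0.
Qed.

Lemma commuting_not_generate g h : g \in G -> h \in G -> h \in 'C[g]%g ->
  ~~ invariably_generate S (coset_class g) (coset_class h).
Proof.
move=> gG hG hg; apply/negP => /forall_inP/(_ _ (class_refl _ _))/forall_inP/(_ _ (class_refl _ _))/eqP e.
case/negP: PSL2_nonabelian; rewrite -e abelian_gen.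
have cm : commute (coset Z g) (coset Z h).
  rewrite /commute -!morphM ?SL2_normZ //; congr (coset Z _).
  by have /cent1P := hg.
apply/centsP=> x /set2P[->|->] y /set2P[->|->] //.
Qed.

Lemma split_not_generate C D : C \in split_classes -> D \in split_classes ->
  ~~ invariably_generate S C D.
Proof.
case/imsetP=> t1 /[!inE] /andP[n1 s1] -> /imsetP[t2 /[!inE] /andP[n2 s2] ->].
have [g [h [gG hG eg eh gh]]] := split_split_comm s1 s2.
by rewrite -eg -eh -!coset_class_trace ?eg ?eh // commuting_not_generate.
Qed.

Lemma nonsplit_not_generate C D : C \in nonsplit_classes -> D \in nonsplit_classes ->
  ~~ invariably_generate S C D.
Proof.
case/imsetP=> t1 /[!inE] n1 -> /imsetP[t2 /[!inE] n2 ->].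
have [g [h [gG hG eg eh gh]]] := nonsplit_comm n1 n2.
by rewrite -eg -eh -!coset_class_trace ?eg ?eh ?nonsplit_sqr // commuting_not_generate.
Qed.

Lemma invariably_generateC (gT : finGroupType) (A C D : {set gT}) :
  invariably_generate A C D = invariably_generate A D C.
Proof.
apply/forall_inP/forall_inP => H x xC; apply/forall_inP => y yD.
  by have /forall_inP/(_ x xC) := H y yD; rewrite setUC.
by have /forall_inP/(_ x xC) := H y yD; rewrite setUC.
Qed.

(** H is the preimage in SL_2 of the subgroup generated by arbitrary representatives, so it contains
    Z. Avoiding [bad_traces] provides the order hypotheses and rules out the second alternative of
    the dichotomy. *)
Lemma good_generate t1 t2 : t1 \in split_traces -> t2 \in nonsplit_traces ->
  (t1, t2) \notin bad_traces F ->
  invariably_generate S (trace_class t1) (trace_class t2).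
Proof.
rewrite [t1 \in _]in_set [t2 \in _]in_set bad_tracesE => /andP[n1 s1] ns2 good.
have o := oner_neq0 F; have c1 := compG t1 o; have c2 := compG t2 o.
apply/forall_inP=> _ /(mem_coset_class c1)[k kG ->].
apply/forall_inP=> _ /(mem_coset_class c2)[l lG ->].
have aG : (comp t1 1%R ^ k)%g \in G by rewrite groupJ.
have bG : (comp t2 1%R ^ l)%g \in G by rewrite groupJ.
have : mtr (comp t1 1%R ^ k)%g = t1 by rewrite mtrJ // mtr_comp.
have : mtr (comp t2 1%R ^ l)%g = t2 by rewrite mtrJ // mtr_comp.
move: (comp t1 1%R ^ k)%g (comp t2 1%R ^ l)%g aG bG => a b aG bG eb ea.
rewrite -ea -eb in n1 s1 ns2 good.
have aZ := parabolicZ aG n1; have bZ := parabolicZ bG (nonsplit_sqr ns2).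
pose A := (<<[set coset Z a; coset Z b]>>)%G.
have sA : A \subset S by rewrite gen_subG subUset !sub1set !mem_quotient.
pose H := (coset Z @*^-1 A)%G.
have sH : H \subset G by rewrite -(quotientGK (center_normal G)) morphpreS.
have sZ : Z \subset H by apply: sub_cosetpre.
have aH : a \in H.
  by rewrite mem_morphpre ?SL2_normZ //= mem_gen // set21.
have bH : b \in H.
  by rewrite mem_morphpre ?SL2_normZ //= mem_gen // set22.
have npow g n : g \in G -> g \notin Z -> (0 < n)%N -> mtr g \notin pow_traces F n -> (g ^+ n)%g != 1%g.
  by move=> gG gZ n0; apply: contra => /eqP; apply: mem_pow_traces.
move: good; rewrite !negb_or => /and3P[g1 g2 /existsPn g3].
have [e|[Q [Q1 dQ lQ xQ yQ]]] := SL2_dichotomy sH sZ aH bH n1 s1 ns2 (npow _ 12%N aG aZ isT g1) (npow _ 12%N bG bZ isT g2).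
  by rewrite -/(gval A) -(cosetpreK A) -[(_ @*^-1 _)%g]/(gval H) e.
have ltQ : (Q < 2 * #|F|)%N.
  by apply: leq_ltn_trans lQ; rewrite expnS expn1 leq_pmulr // ltnW.
have := g3 (Ordinal ltQ); rewrite /= Q1 dQ lQ /= !mem_pow_traces //.
by rewrite muln_gt0 /= -ltnS prednK // ltnW.
Qed.
End Classes.

(** * Counting traces, classes and generating pairs *)

Section Counting.
Variables (F : finFieldType).
Local Open Scope ring_scope.
Implicit Types (g h k : GL2 F) (t l : F) (T : {set F}).
Local Notation G := (SL2 F).
Local Notation Z := ('Z(G)%g).
Local Notation S := (G / Z)%G.
Local Notation signs := [set (1 : F); -1].

Lemma trace_class_inj t1 t2 : trace_class t1 = trace_class t2 -> t2 = t1 \/ t2 = - t1.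
Proof.
have o := oner_neq0 F; move/(coset_class_eq_trace (compG t1 o) (compG t2 o)).
by rewrite !mtr_comp.
Qed.

(** The fibre consists of t and -t. Writing its size as [#|signs|], which is 1 in characteristic 2
    and 2 otherwise, avoids a case distinction. *)
Lemma trace_class_fiber T t : (forall x, (- x \in T) = (x \in T)) ->
  (forall x, x \in T -> x ^+ 2 != 4) -> t \in T :\ 0 ->
  #|[set y in T :\ 0 | trace_class y == trace_class t]| = #|signs|.
Proof.
move=> TN T4 /setD1P[t0 tT].
have <- : #|[set t * s | s in signs]| = #|signs|.
  by apply: card_imset; apply: mulfI.
congr #|pred_of_set _|; apply/setP=> y; rewrite inE in_setD1.
apply/idP/imsetP => [/andP[/andP[y0 yT] /eqP/esym/trace_class_inj[->|->]] | [s]].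
- by exists 1; rewrite ?mulr1 // set21.
- by exists (-1); rewrite ?mulrN1 // set22.
case/set2P=> -> ->; first by rewrite mulr1 t0 tT eqxx.
by rewrite mulrN1 oppr_eq0 t0 TN tT trace_class_neg ?eqxx // T4.
Qed.

(** Trace 0 is its own negative and is set apart; it accounts for at most one trace and one class,
    whence the errors 1 and 2. *)
Lemma card_trace_classes T : (forall x, (- x \in T) = (x \in T)) ->
  (forall x, x \in T -> x ^+ 2 != 4) ->
  (#|T| <= #|signs| * #|[set trace_class t | t in T]| + 1)%N /\
  (#|signs| * #|[set trace_class t | t in T]| <= #|T| + 2)%N.
Proof.
move=> TN T4; have fib := trace_class_fiber TN T4.
have ge : (#|T :\ 0%R| <= #|signs| * #|[set trace_class t | t in T :\ 0%R]|)%N.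
  by apply: card_fiber_ge => t tT; rewrite fib.
have le : (#|signs| * #|[set trace_class t | t in T :\ 0%R]| <= #|T :\ 0%R|)%N.
  by apply: card_fiber_le => t tT; rewrite fib.
have s2 : (#|signs| <= 2)%N by rewrite cards2; case: eqP.
have T1 := cardsD1 0 T.
have i1 : (#|[set trace_class t | t in T :\ 0%R]| <= #|[set trace_class t | t in T]|)%N.
  by apply: subset_leq_card; apply: imsetS; apply: subsetDl.
have i2 : (#|[set trace_class t | t in T]| <= #|[set trace_class t | t in T :\ 0%R]| + 1)%N.
  apply: (@leq_trans #|trace_class 0 |: [set trace_class t | t in T :\ 0%R]|).
    apply: subset_leq_card; apply/subsetP=> _ /imsetP[t tT ->].
    have [->|t0] := eqVneq t 0; first exact: setU11.
    by apply/setU1r/imset_f; rewrite in_setD1 t0.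
  by rewrite cardsU1 addnC leq_add2l; case: (_ \notin _).
have b1 : (nat_of_bool (0%R \in T) <= 1)%N by case: (_ \in _).
move: ge le s2 T1 i1 i2 b1.
move: #|signs| #|_ @: T| #|_ @: (T :\ 0)| #|T| #|T :\ 0| (nat_of_bool _); clear.
move=> z c c1 n n1 b ge le z2 -> i1 i2 b1; split.
  have := leq_mul (leqnn z) i1; lia.
have := leq_mul (leqnn z) i2; rewrite mulnDr; lia.
Qed.

Lemma split_traces_imset :
  split_traces F = [set l + l^-1 | l in [set l | (l != 0) && (l ^+ 2 != 1)]].
Proof.
have disc l : l != 0 -> (l + l^-1) ^+ 2 - 4 = (l - l^-1) ^+ 2 by move=> l0; field.
have sq l : l != 0 -> (l - l^-1 == 0) = (l ^+ 2 == 1).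
  move=> l0; rewrite subr_eq0 -(inj_eq (mulfI l0)) divff // expr2 //.
apply/setP=> t; rewrite in_set; apply/andP/imsetP => [[t4 /has_eigP[l el]]|[l]].
  have l0 := eig_neq0 el; exists l; last exact: eig_tr.
  by move: t4; rewrite (eig_tr el) -subr_eq0 disc // sqrf_eq0 sq // inE l0.
rewrite inE => /andP[l0 l1] ->; rewrite -subr_eq0 disc // sqrf_eq0 sq //; split=> //.
by apply/has_eigP; exists l; field.
Qed.

(** The map from l to l + l^-1 is two-to-one away from 0, 1 and -1, which are two or three elements
    according to the characteristic. *)
Lemma card_split_traces : (#|F| <= 2 * #|split_traces F| + 3)%N /\
  (2 * #|split_traces F| + 2 <= #|F|)%N.
Proof.
pose D := [set l : F | (l != 0) && (l ^+ 2 != 1)].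
have fib l : l \in D -> #|[set m in D | m + m^-1 == l + l^-1]| = 2.
  rewrite inE => /andP[l0 l1]; transitivity #|[set l; l^-1]|; last first.
    rewrite cards2; suff -> : l != l^-1 by [].
    by apply: contra l1 => /eqP e; rewrite expr2 {2}e divff.
  congr #|pred_of_set _|; apply/setP=> m; rewrite !inE.
  have key : m != 0 -> (m + m^-1 == l + l^-1) = (m == l) || (m == l^-1).
    move=> m0; have E : (m - l) * (m - l^-1) = m * (m + m^-1 - (l + l^-1)).
      by field; rewrite l0 m0.
    by rewrite -[m == l]subr_eq0 -[m == l^-1]subr_eq0 -mulf_eq0 E mulf_eq0 (negPf m0) subr_eq0.
  apply/idP/idP => [/andP[/andP[m0 _]]|]; first by rewrite key.
  case/orP=> /eqP ->; first by rewrite l0 l1 eqxx.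
  by rewrite invr_eq0 l0 exprVn invr_eq1 l1 invrK addrC eqxx.
have c1 : (#|D| <= 2 * #|split_traces F|)%N.
  by rewrite split_traces_imset; apply: card_fiber_ge => l lD; rewrite fib.
have c2 : (2 * #|split_traces F| <= #|D|)%N.
  by rewrite split_traces_imset; apply: card_fiber_le => l lD; rewrite fib.
have cD := cardsC D.
have d1 : (#|~: D| <= 3)%N.
  apply: (@leq_trans #|[set (0 : F); 1; -1]|); last first.
    by rewrite cardsU cards1 cards2; case: (_ != _); lia.
  apply: subset_leq_card; apply/subsetP=> l; rewrite !inE negb_and !negbK.
  by rewrite sqrf_eq1 orbA.
have d2 : (2 <= #|~: D|)%N.
  have <- : #|[set (0 : F); 1]| = 2%N by rewrite cards2 eq_sym oner_neq0.
  apply: subset_leq_card; apply/subsetP=> l; rewrite !inE => /orP[] /eqP ->.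
    by rewrite eqxx.
  by rewrite expr1n eqxx andbF.
move: c1 c2 cD d1 d2; move: #|D| #|~: D| #|split_traces F| #|F|; clear; lia.
Qed.

Lemma card_nonsplit_traces :
  (#|split_traces F| + #|nonsplit_traces F| + 1 <= #|F|)%N /\
  (#|F| <= #|split_traces F| + #|nonsplit_traces F| + 2)%N.
Proof.
pose E := [set t : F | t ^+ 2 == 4].
have e1 : (1 <= #|E|)%N.
  by apply/card_gt0P; exists 2; rewrite inE; apply/eqP; ring.
have e2 : (#|E| <= 2)%N.
  apply: (@leq_trans #|[set (2 : F); -2]|); last by rewrite cards2; case: eqP.
  apply: subset_leq_card; apply/subsetP=> t; rewrite inE => /eqP/sqr4 [] ->; rewrite !inE eqxx ?orbT //.
have d1 : split_traces F :&: nonsplit_traces F = set0.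
  by apply/setP=> t; rewrite !inE; case: has_eig; rewrite ?andbF.
have cov : ~: E = split_traces F :|: nonsplit_traces F.
  apply/setP=> t; rewrite !inE; case: eqP => /= [e|]; last by case: has_eig.
  by rewrite parabolic_eig.
have := cardsC E; rewrite cov cardsU d1 cards0 subn0.
move: e1 e2; move: #|E| #|split_traces F| #|nonsplit_traces F| #|F|; clear; lia.
Qed.

Definition other_classes := classes S :\: (split_classes F :|: nonsplit_classes F).

(** Besides the trivial class there are at most two parabolic ones: multiplication by -1 turns trace
    -2 into 2, where [parabolic_conj] leaves two candidates. *)
Lemma card_other_classes : (#|other_classes| <= 3)%N.
Proof.
have [e [e0 par]] := parabolic_conj F.
have [c cZ ec] := neg1_center F; have cG : c \in G := subsetP (center_sub _) c cZ.
have sub : other_classes \subset [set coset_class 1; coset_class (comp 2 1); coset_class (comp 2 e)].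
  apply/subsetP=> C /setDP[/coset_classP[g gG ->]]; rewrite in_setU negb_or => /andP[ns nn].
  have [gZ|gZ] := boolP (g \in Z).
    by rewrite -[g]mulg1 coset_class_central // !inE eqxx.
  have [/eqP t4|t4] := boolP (mtr g ^+ 2 == 4); last first.
    have [sg|sg] := boolP (has_eig (mtr g)).
      by case/negP: ns; rewrite coset_class_trace // imset_f // inE t4.
    by case/negP: nn; rewrite coset_class_trace // imset_f // inE sg.
  have par2 h : h \in G -> h \notin Z -> mtr h = 2 ->
      coset_class h \in [set coset_class 1; coset_class (comp 2 1); coset_class (comp 2 e)].
    move=> hG hZ ht; have [M MG eM] := par _ hG hZ.
    by rewrite -(coset_classJ hG MG) !inE; case: eM => ->; rewrite ht eqxx ?orbT.
  case/sqr4: t4 => tg; first exact: par2.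
  rewrite -(coset_class_central g cZ); apply: par2.
  - exact: groupM cG gG.
  - by rewrite groupMl.
  - by rewrite ec tg opprK.
apply: leq_trans (subset_leq_card sub) _.
by rewrite cardsU cards1 cards2; case: (_ != _); lia.
Qed.

Lemma split_nonsplit_disjoint : split_classes F :&: nonsplit_classes F = set0.
Proof.
apply/setP=> C; rewrite in_setI in_set0; apply/negP=> /andP[/imsetP[t1 + ->] /imsetP[t2 + e]].
rewrite !inE => /andP[_ s1] /negP; apply.
by case: (trace_class_inj e) => ->; rewrite ?has_eigN.
Qed.

Lemma sub_split_classes : split_classes F \subset classes S.
Proof.
by apply/subsetP=> _ /imsetP[t _ ->]; apply: coset_class_in; apply: compG; apply: oner_neq0.
Qed.

Lemma sub_nonsplit_classes : nonsplit_classes F \subset classes S.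
Proof.
by apply/subsetP=> _ /imsetP[t _ ->]; apply: coset_class_in; apply: compG; apply: oner_neq0.
Qed.

Lemma card_PSL2_classes :
  #|classes S| = (#|split_classes F| + #|nonsplit_classes F| + #|other_classes|)%N.
Proof.
have sub : split_classes F :|: nonsplit_classes F \subset classes S.
  by rewrite subUset sub_split_classes sub_nonsplit_classes.
rewrite -(cardsID (split_classes F :|: nonsplit_classes F) (classes S)) (setIidPr sub).
by rewrite cardsU split_nonsplit_disjoint cards0 subn0.
Qed.

Definition good_pairs := [set CD in class_pairs S | invariably_generate S CD.1 CD.2].

Lemma good_pairs_upper : (#|good_pairs| <=
  2 * (#|split_classes F| * #|nonsplit_classes F|)
  + 2 * (#|other_classes| * #|classes S|))%N.
Proof.
set s := split_classes F; set n := nonsplit_classes F; set u := other_classes.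
have sub : good_pairs \subset (setX s n :|: setX n s) :|: (setX u (classes S) :|: setX (classes S) u).
  apply/subsetP=> -[C D]; rewrite inE in_setX /= => /andP[/andP[CK DK] gen].
  rewrite !in_setU !in_setX CK DK andbT /= .
  have tri E : E \in classes S -> [|| E \in s, E \in n | E \in u].
    by move=> EK; rewrite [E \in u]in_setD EK in_setU andbT orbA orbN.
  case/or3P: (tri _ CK) => cC; case/or3P: (tri _ DK) => cD; rewrite ?cC ?cD ?orbT //.
    by rewrite (negPf (split_not_generate cC cD)) in gen.
  by rewrite (negPf (nonsplit_not_generate cC cD)) in gen.
apply: leq_trans (subset_leq_card sub) _; apply: leq_trans (leq_card_setU _ _) _.
rewrite !mul2n -!addnn; apply: leq_add; apply: leq_trans (leq_card_setU _ _) _; rewrite !cardsX.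
  by rewrite leq_add2l mulnC.
by rewrite leq_add2l mulnC.
Qed.

(** A mixed pair can fail only as the image of a bad pair of traces; both orders occur, so the 40 q
    exceptions count twice. *)
Lemma good_pairs_lower : (2 * (#|split_classes F| * #|nonsplit_classes F|)
  <= #|good_pairs| + 80 * #|F|)%N.
Proof.
set s := split_classes F; set n := nonsplit_classes F.
pose B := [set (trace_class t.1, trace_class t.2) | t in bad_traces F].
pose B' := [set (trace_class t.2, trace_class t.1) | t in bad_traces F].
have sub : setX s n :|: setX n s \subset good_pairs :|: (B :|: B').
  apply/subsetP=> -[C D]; rewrite !in_setU !in_setX /= => /orP[] /andP[].
    move=> Cs Dn; have CK := subsetP sub_split_classes _ Cs; have DK := subsetP sub_nonsplit_classes _ Dn.
    case/imsetP: Cs => t1 t1s eC; case/imsetP: Dn => t2 t2n eD.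
    have [b|b] := boolP ((t1, t2) \in bad_traces F).
      by apply/or3P/Or32/imsetP; exists (t1, t2); rewrite //= eC eD.
    by apply/or3P/Or31; rewrite inE in_setX CK DK /= eC eD good_generate.
  move=> Cn Ds; have CK := subsetP sub_nonsplit_classes _ Cn; have DK := subsetP sub_split_classes _ Ds.
  case/imsetP: Cn => t2 t2n eC; case/imsetP: Ds => t1 t1s eD.
  have [b|b] := boolP ((t1, t2) \in bad_traces F).
    by apply/or3P/Or33/imsetP; exists (t1, t2); rewrite //= eC eD.
  by apply/or3P/Or31; rewrite inE in_setX CK DK /= invariably_generateC eC eD good_generate.
have := subset_leq_card sub; rewrite cardsU.
have -> : setX s n :&: setX n s = set0.
  apply/setP=> -[C D]; rewrite in_setI !in_setX in_set0 /=; apply/negP=> /andP[/andP[Cs _] /andP[Cn _]].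
  by have := in_set0 C; rewrite -split_nonsplit_disjoint in_setI Cs Cn.
rewrite cards0 subn0 !cardsX [(#|n| * _)%N]mulnC addnn -mul2n => /leq_trans; apply.
apply: leq_trans (leq_card_setU _ _) _; rewrite leq_add2l.
apply: leq_trans (leq_card_setU _ _) _.
rewrite -[80%N]/(40 + 40)%N mulnDl; apply: leq_add;
  exact: leq_trans (leq_imset_card _ _) (card_bad_traces F).
Qed.
End Counting.

(** * Arithmetic of the final estimate *)

Lemma class_number_bounds (q z a b s n u : nat) :
  (0 < z <= 2)%N -> (u <= 3)%N ->
  (q <= 2 * a + 3)%N -> (2 * a + 2 <= q)%N -> (a + b + 1 <= q)%N -> (q <= a + b + 2)%N ->
  (a <= z * s + 1)%N -> (z * s <= a + 2)%N -> (b <= z * n + 1)%N -> (z * n <= b + 2)%N ->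
  (0 < s + n + u)%N -> (3 < q)%N ->
  [/\ (q <= 8 * (s + n + u))%N, (s + n + u <= 3 * q)%N & (s <= n + 5)%N && (n <= s + 5)%N].
Proof. by move=> /one_or_two[->|->]; rewrite ?mul1n => *; split; lia. Qed.

(** The difference of (s + n + u)^2 and 4 s n is (s - n)^2 <= 25 plus terms in u. The 200 q absorbs
    twice 80 q, at most 18 q from 2 u (s + n), and constants. *)
Lemma good_pairs_half (q s n u g : nat) :
  (u <= 3)%N -> (s <= n + 5)%N -> (n <= s + 5)%N -> (3 < q)%N -> (s + n + u <= 3 * q)%N ->
  (g <= 2 * (s * n) + 2 * (u * (s + n + u)))%N -> (2 * (s * n) <= g + 80 * q)%N ->
  (2 * g <= (s + n + u) ^ 2 + 200 * q)%N /\ ((s + n + u) ^ 2 <= 2 * g + 200 * q)%N.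
Proof.
move=> u3 sn ns q4 kq up lo.
have uk : (u * (s + n + u) <= 3 * (3 * q))%N by apply: leq_mul.
have us : (u * (s + n) <= 3 * (3 * q))%N.
  by apply: leq_mul => //; apply: leq_trans kq; apply: leq_addr.
have uu : (u * u <= 3 * 3)%N by apply: leq_mul.
have e : ((s + n + u) ^ 2 = (s + n) ^ 2 + 2 * (u * (s + n)) + u * u)%N.
  by rewrite sqrnD; ring.
have e1 : (4 * (s * n) <= (s + n) ^ 2)%N.
  by rewrite sqrnD; have := (nat_Cauchy s n).1; lia.
have e2 : ((s + n) ^ 2 <= 4 * (s * n) + 25)%N.
  have [le|le] := leqP s n.
    have := leq_mul (_ : n - s <= 5)%N (_ : n - s <= 5)%N.
    rewrite leq_subLR addnC [(5 + s)%N]addnC ns => /(_ isT isT) h.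
    rewrite -(subnK le) in h *; move: (n - s)%N h => d; rewrite addnK => h; rewrite !sqrnD; lia.
  have := leq_mul (_ : s - n <= 5)%N (_ : s - n <= 5)%N.
  rewrite leq_subLR [(n + 5)%N]addnC addnC sn => /(_ isT isT) h.
  rewrite -(subnK (ltnW le)) in h *; move: (s - n)%N h => d; rewrite addnK => h; rewrite !sqrnD; lia.
by rewrite e; split; lia.
Qed.

(** The error is (2 g - k^2) / (2 k^2), and q^2 <= 64 k^2 gives the factor 64 / 2 = 32. *)
Lemma half_estimate (c q k g : nat) : (0 < q)%N -> (q <= 8 * k)%N ->
  (2 * g <= k ^ 2 + c * q)%N -> (k ^ 2 <= 2 * g + c * q)%N ->
  (`|g%:R / (k * k)%:R - 1 / 2 : rat| <= 32 * c%:R / q%:R)%R.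
Proof.
move=> q0 qk up lo.
have k0 : (0 < k)%N by lia.
have [qp kp] : (0 < q%:R :> rat)%R /\ (0 < k%:R :> rat)%R by rewrite !ltr0n.
have c0 : (0 <= c%:R :> rat)%R by apply: ler0n.
move: qk up lo; rewrite -!(ler_nat rat) !(natrD, natrM, natrX).
move: q%:R%R k%:R%R g%:R%R c%:R%R qp kp c0 => {q0 k0} {}q {}k {}g {}c q0 k0 c0 qk up lo.
have -> : (g / (k * k) - 1 / 2 = (2 * g - k ^+ 2) / (2 * k ^+ 2))%R.
  by field; rewrite gt_eqF.
have k2 : (0 < 2 * k ^+ 2)%R by rewrite mulr_gt0 // exprn_gt0.
have n1 : (`|2 * g - k ^+ 2| <= c * q)%R by rewrite ler_norml; lra.
rewrite normrM normfV (gtr0_norm k2) (ler_pdivrMr _ _ k2).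
apply: le_trans n1 _; rewrite mulrAC (ler_pdivlMr _ _ q0).
have := ler_wpM2l c0 (ler_pM (ltW q0) (ltW q0) qk qk); lra.
Qed.

Theorem theorem1p2 :
  exists K : rat, forall F : finFieldType, (4 <= #|F|)%N ->
    (`|prob_invariably_generate (PSL 2 F) - 1 / 2| <= K / #|F|%:R)%R.
Proof.
exists (32 * 200%:R)%R => F q4.
have [t1 t2] := card_split_traces F; have [t3 t4] := card_nonsplit_traces F.
have [|| s1 s2] := @card_trace_classes F (split_traces F).
- by move=> t; rewrite !inE sqrrN has_eigN.
- by move=> t; rewrite inE => /andP[].
have [|| s3 s4] := @card_trace_classes F (nonsplit_traces F).
- by move=> t; rewrite !inE has_eigN.
- by move=> t; rewrite inE; apply: nonsplit_sqr.
have z2 : (0 < #|[set (1 : F)%R; (-1)%R]| <= 2)%N by rewrite cards2; case: eqP.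
have u3 := card_other_classes F; have up := good_pairs_upper F; have lo := good_pairs_lower F.
have ek := card_PSL2_classes F.
have k0 : (0 < #|classes (SL2 F / 'Z(SL2 F))|)%N.
  by apply/card_gt0P; exists 1; apply: classes1.
rewrite ek in k0 up.
have [qk kq /andP[sn ns]] := class_number_bounds z2 u3 t1 t2 t3 t4 s1 s2 s3 s4 k0 q4.
have [g1 g2] := good_pairs_half u3 sn ns q4 kq up lo.
rewrite /prob_invariably_generate cardsX.
apply: (@half_estimate 200 #|F| #|classes (SL2 F / 'Z(SL2 F))| #|good_pairs F|); rewrite ?ek //.
exact: leq_trans q4.
Qed.
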